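(* Let $\mathbb{K}$ be a field, $s,b\ge1$ integers, and $Z=\mathbb{K}[z_{i,j}:1\le i\le s,\ 1\le j\le b]$ with the standard grading. If $J$ is a sparse symmetric shifted ideal in $Z$, then for all $i$ and $d$ the graded Betti number $\beta_{i,i+d}(J)=\dim_{\mathbb{K}}\operatorname{Tor}^Z_i(J,\mathbb{K})_{i+d}$ is given by $$\sum_{\substack{\boldsymbol\lambda\in\Lambda(J)\\ \operatorname{suppdeg}(\boldsymbol\lambda)=d}}\left(\sum_{k+\ell=i}\frac{p(\boldsymbol\lambda)!}{\operatorname{type}(\pi_{\boldsymbol\lambda})!}\binom{p^{\vartriangle}(\boldsymbol\lambda)}{\ell}\binom{s}{p(\boldsymbol\lambda)}\binom{s-p(\boldsymbol\lambda)}{r(\boldsymbol\lambda)+k}\binom{r(\boldsymbol\lambda)+k-1}{k}\right),$$ where $k,\ell$ range over nonnegative integers.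
   Context: For $\boldsymbol\mu=(\mu_1,\dots,\mu_s)\in\{0,1,\dots,b\}^s$ put $\boldsymbol z^{\boldsymbol\mu}=\prod_{i=1}^s z_{i,\mu_i}$, with the convention $z_{i,0}=1$; such a monomial is called a sparse squarefree monomial. For two such tuples, $\boldsymbol\mu'\le_0\boldsymbol\mu$ means: $\mu_i'\le\mu_i$ for each $i$, and $\mu_i'=0$ if and only if $\mu_i=0$. The permutation group $\mathfrak{S}_s$ acts on $Z$ by $\mathbb{K}$-algebra automorphisms with $\sigma(z_{i,j})=z_{\sigma(i),j}$. For a monomial ideal $J$, $G(J)$ denotes its set of minimal monomial generators. A squarefree monomial proper ideal $J$ of $Z$ is sparse symmetric shifted if: (S-1) $J$ is generated by sparse squarefree monomials; (S-2) whenever $\boldsymbol z^{\boldsymbol\mu}\in G(J)$ and $\boldsymbol\mu'\le_0\boldsymbol\mu$, then $\boldsymbol z^{\boldsymbol\mu'}\in J$; (S-3) $J$ is invariant under the action of $\mathfrak{S}_s$. A partition (of length $s$) is a tuple $\boldsymbol\lambda=(\lambda_1\le\cdots\le\lambda_s)$ of nonnegative integers. For $f=\boldsymbol z^{\boldsymbol\mu}$, $\boldsymbol\lambda(f)$ is the partition obtained by sorting $\mu_1,\dots,\mu_s$ in weakly increasing order. Set $\Lambda(J)=\{\boldsymbol\lambda(f):f\in G(J)\}$. For a partition $\boldsymbol\lambda$: $|\boldsymbol\lambda|=\lambda_1+\cdots+\lambda_s$; $\operatorname{suppdeg}(\boldsymbol\lambda)$ is the number of nonzero entries; $p(\boldsymbol\lambda)=|\{j:1\le\lambda_j<\lambda_s\}|$;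 $r(\boldsymbol\lambda)=|\{j:\lambda_j=\lambda_s\}|$; $\pi_{\boldsymbol\lambda}$ is the subsequence of the entries $\lambda_j$ with $1\le\lambda_j<\lambda_s$; $\operatorname{type}(\pi_{\boldsymbol\lambda})!=t_1!\,t_2!\cdots t_{\lambda_s-1}!$ where $t_k=|\{j:\lambda_j=k\}|$ for $1\le k\le\lambda_s-1$ (empty product $=1$); and $$p^{\vartriangle}(\boldsymbol\lambda)=|\boldsymbol\lambda|+s(\lambda_s-1)-\lambda_s\operatorname{suppdeg}(\boldsymbol\lambda).$$ *)

(* Defs.v *)
From HB Require Import structures.
From mathcomp Require Export all_boot all_order all_fingroup all_algebra.
From mathcomp Require Export mpoly.

Set Implicit Arguments.
Unset Strict Implicit.
Unset Printing Implicit Defensive.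

Import GRing.Theory.
Local Open Scope ring_scope.

(** ** Graded free resolutions and Tor *)

Section GradedBetti.
Variables (K : fieldType) (n : nat).
Notation Z := {mpoly K[n]}.

(** Homogeneity for the standard grading, in an integer degree; the zero
    polynomial is homogeneous of every degree. *)
Definition homogeneous_in (e : int) (p : Z) : Prop :=
  forall m : 'X_{1..n}, m \in msupp p -> (mdeg m)%:Z = e.

(** The data of a diagram [... -> F_1 -> F_0 -> Z], where [F_i] is the graded
    free module with a basis of [rk i] elements, the [c]-th one in degree
    [dg i c].  Elements of [F_i] are row vectors and maps act on the right. *)
Record free_complex := FreeComplex {
  rk : nat -> nat;
  dg : forall i, 'I_(rk i) -> int;
  dif : forall i, 'M[Z]_(rk i.+1, rk i);
  aug : 'cV[Z]_(rk 0)
}.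

Arguments rk : clear implicits.
Arguments dg : clear implicits.
Arguments dif : clear implicits.
Arguments aug : clear implicits.

(** [... -> F_1 -> F_0 -> J -> 0] is exact and its maps preserve degrees. *)
Definition free_resolution (J : {pred Z}) (F : free_complex) : Prop :=
  [/\ (forall c, homogeneous_in (dg F 0 c) (aug F c 0))
        /\ (forall i r c, homogeneous_in (dg F i.+1 r - dg F i c) (dif F i r c)),
      (forall f : Z, f \in J <-> exists u : 'rV[Z]_(rk F 0), (u *m aug F) 0 0 = f),
      (forall u : 'rV[Z]_(rk F 0),
         u *m aug F = 0 <-> exists v : 'rV[Z]_(rk F 1), v *m dif F 0 = u)
    & forall i (u : 'rV[Z]_(rk F i.+1)),
         u *m dif F i = 0 <-> exists v : 'rV[Z]_(rk F i.+2), v *m dif F i.+1 = u].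

(** [F_i] tensored with [K = Z / (variables)] is the space of row vectors
    ['rV[K]_(rk i)], graded by [dg], and the differentials become the matrices of
    constant terms.  Subspaces are represented by matrices spanning them. *)
Definition dif_K (F : free_complex) i : 'M[K]_(rk F i.+1, rk F i) :=
  map_mx (mcoeff 0%MM) (dif F i).

Definition cycles_K (F : free_complex) i : 'M[K]_(rk F i) :=
  if i is i'.+1 then kermx (dif_K F i') else 1%:M.

Definition degree_part (F : free_complex) i (j : int) : 'M[K]_(rk F i) :=
  diag_mx (\row_c (dg F i c == j)%:R).

(** The dimension of the degree [j] part of the [i]-th homology of [F (x) K]. *)
Definition tor_dim (F : free_complex) (i : nat) (j : int) : nat :=
  (\rank (cycles_K F i :&: degree_part F i j)%MS
   - \rank (dif_K F i :&: degree_part F i j)%MS)%N.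

(** [dim_K Tor_i(J, K)_j = N]: graded free resolutions of [J] exist, and every
    one of them computes the value [N]. *)
Definition graded_betti (J : {pred Z}) (i : nat) (j : int) (N : nat) : Prop :=
  (exists F, free_resolution J F) /\
  (forall F, free_resolution J F -> tor_dim F i j = N).

End GradedBetti.

(** ** Monomial ideals; a monomial is identified with its exponent vector *)

Section MonomialIdeals.
Variables (K : fieldType) (n : nat).
Notation Z := {mpoly K[n]}.

Definition generated_by (J : {pred Z}) (A : 'X_{1..n} -> Prop) : Prop :=
  forall f : Z, f \in J <->
    exists2 r : seq (Z * 'X_{1..n}),
      (forall x, x \in r -> A x.2) & f = \sum_(x <- r) x.1 * 'X_[x.2].

Definition squarefree_monomial_ideal (J : {pred Z}) : Prop :=
  exists2 A : 'X_{1..n} -> Prop,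
    (forall m, A m -> forall t, (m t <= 1)%N) & generated_by J A.

(** [G(J)]: the monomials of [J] that no other monomial of [J] divides.  The
    bound on the degree of [m'] holds for every divisor of [m]. *)
Definition mingens (J : {pred Z}) : {pred 'X_{1..n}} := fun m =>
  ('X_[m] \in J) &&
  [forall m' : 'X_{1..n < (mdeg m).+1},
     ('X_[m'] \in J) && (m' <= m)%MM ==> (m' == m :> 'X_{1..n})].

End MonomialIdeals.

(** ** Sparse symmetric shifted ideals

    The variable [z_{i,j}] is ['X_(mxvec_index i j')], where [j' : 'I_b] has value
    [j - 1].  A tuple [mu] takes its values in ['I_b.+1], i.e. in {0, ..., b}. *)

Section SparseSymmetricShifted.
Variables (K : fieldType) (s b : nat).
Notation Z := {mpoly K[s * b]}.

Definition sparse_mon (mu : s.-tuple 'I_b.+1) : 'X_{1..s * b} :=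
  (\sum_(i < s)
     if unlift ord0 (tnth mu i) is Some j then U_(mxvec_index i j) else 0)%MM.

Definition le0 (mu' mu : s.-tuple 'I_b.+1) : Prop :=
  forall i, (tnth mu' i <= tnth mu i)%N
            /\ (tnth mu' i = ord0 <-> tnth mu i = ord0).

Definition sym_act (sigma : 'S_s) (f : Z) : Z :=
  f \mPo [tuple mxvec (\matrix_(i < s, j < b) ('X_(mxvec_index (sigma i) j) : Z)) 0 k
         | k < s * b].

(** [idealr_closed] includes properness. *)
Record sparse_symmetric_shifted (J : {pred Z}) : Prop := SparseSymmetricShifted {
  sss_ideal : idealr_closed J;
  sss_squarefree : squarefree_monomial_ideal J;
  sss_sparse : exists A : s.-tuple 'I_b.+1 -> Prop,
    generated_by J (fun m => exists2 mu, A mu & m = sparse_mon mu);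
  sss_shifted : forall mu mu' : s.-tuple 'I_b.+1,
    sparse_mon mu \in mingens J -> le0 mu' mu -> 'X_[sparse_mon mu'] \in J;
  sss_symmetric : forall (sigma : 'S_s) (f : Z), f \in J -> sym_act sigma f \in J
}.

Definition part_of (mu : s.-tuple 'I_b.+1) : seq nat :=
  sort leq [seq val x | x <- mu].

Definition Lambda (J : {pred Z}) : seq (seq nat) :=
  undup [seq part_of mu | mu : s.-tuple 'I_b.+1 in
           [pred mu : s.-tuple 'I_b.+1 | sparse_mon mu \in mingens J]].

End SparseSymmetricShifted.

(** ** Statistics of a partition, given as a weakly increasing sequence *)

Section Partitions.
Local Open Scope nat_scope.
Implicit Type l : seq nat.

Definition part_max l := last 0 l.
Definition suppdeg l := count (fun x => x != 0) l.
Definition part_pi l := [seq x <- l | 1 <= x < part_max l].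
Definition part_p l := size (part_pi l).
Definition part_r l := count_mem (part_max l) l.
Definition type_fact l := \prod_(1 <= k < part_max l) (count_mem k l)`!.

(** The subtractions are not truncated when [part_max l > 0], since the value is
    [(size l - suppdeg l) * (part_max l - 1) + (sumn l - suppdeg l)]. *)
Definition p_triangle l :=
  sumn l + size l * (part_max l - 1) - part_max l * suppdeg l.

End Partitions.

(* Main.v *)
From Stdlib Require Import IndefiniteDescription.
From mathcomp Require Import ring zify.
Require Import Defs.

(** Add the minimal generators of J one at a time, in order of nondecreasing
    degree.  If each one has, modulo the previous ones, a colon ideal generated
    by variables, then an iterated mapping cone of Koszul complexes resolves J.
    The degrees force this resolution to be minimal, so a generator of degree e
    whose colon ideal has q generators contributes 'C(q, i) to beta_{i,i+e};
    comparison up to homotopy transfers the result to all resolutions.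

    For the generator z^mu with largest entry M, (S-2) and (S-3) allow one to
    lower an entry or to move it to a position where mu is zero.  Ordering by
    [weight], q is the number of such moves that decrease the weight, which is
    p_triangle plus the number of zeros of mu before its last entry M.

    Vandermonde reduces the sum over the rearrangements of lambda to the sums
    of 'C(zeros before the last M, k).  These are averages over the symmetric
    group: among the r positions of M and k given zeros, each one is equally
    likely to come last. *)

Set Implicit Arguments.
Unset Strict Implicit.
Unset Printing Implicit Defensive.

Import Order.TTheory GRing.Theory Num.Theory.
Local Open Scope ring_scope.

(** * Homogeneous lifting and comparison of resolutions *)

Section Homogeneous.
Variables (K : fieldType) (n : nat).
Notation Z := {mpoly K[n]}.
Implicit Types (p q : Z) (e f : int).

Lemma homogeneous_in_eq e f p : e = f -> homogeneous_in e p -> homogeneous_in f p.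
Proof. by move->. Qed.

Lemma homogeneous_in0 e : homogeneous_in e (0 : Z).
Proof. by move=> m; rewrite msupp0. Qed.

Lemma homogeneous_inX m : homogeneous_in (mdeg m) ('X_[m] : Z).
Proof. by move=> m'; rewrite msuppX inE => /eqP->. Qed.

Lemma homogeneous_in1 : homogeneous_in 0 (1 : Z).
Proof. by move=> m; rewrite -mpolyX0 => /homogeneous_inX; rewrite mdeg0. Qed.

Lemma homogeneous_inN e p : homogeneous_in e p -> homogeneous_in e (- p).
Proof. by move=> hp m; rewrite (perm_mem (msuppN _)) => /hp. Qed.

Lemma homogeneous_inM e f p q :
  homogeneous_in e p -> homogeneous_in f q -> homogeneous_in (e + f) (p * q).
Proof.
move=> hp hq m /msuppM_le /allpairsP[[m1 m2] /= [/hp h1 /hq h2 ->]].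
by rewrite mdegD PoszD h1 h2.
Qed.

Lemma homogeneous_in_sum (I : finType) e (F : I -> Z) :
  (forall i, homogeneous_in e (F i)) -> homogeneous_in e (\sum_i F i).
Proof.
by move=> hF m /msupp_sum_le /flattenP[_ /mapP[i _ ->]] /hF.
Qed.

(** Minimality of a complex is always read off from degrees through this fact. *)
Lemma homogeneous_in_mcoeff0 e p : e != 0 -> homogeneous_in e p -> p@_0%MM = 0.
Proof.
move=> e0 hp; apply/eqP/negPn/negP; rewrite -mcoeff_msupp => /hp.
by rewrite mdeg0 => /esym/eqP; rewrite (negPf e0).
Qed.

Lemma homogeneous_split e p : exists2 q, homogeneous_in e q &
  forall m, m \in msupp (p - q) -> (mdeg m)%:Z != e.
Proof.
exists (\sum_(m <- msupp p | (mdeg m)%:Z == e) p@_m *: 'X_[m]).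
  move=> m /msupp_sum_le /flattenP[s /mapP[m1]].
  by rewrite mem_filter => /andP[/eqP h _] -> /msuppZ_le; rewrite msuppX inE => /eqP->.
move=> m; rewrite {1}(mpolyE p) (bigID (fun m : 'X_{1..n} => (mdeg m)%:Z == e)) /=.
rewrite addrAC subrr add0r => /msupp_sum_le /flattenP[s /mapP[m1]].
by rewrite mem_filter => /andP[h _] -> /msuppZ_le; rewrite msuppX inE => /eqP->.
Qed.

Definition homogeneous_mx k l (t : 'I_k -> int) (t' : 'I_l -> int) (U : 'M[Z]_(k, l)) :=
  forall r c, homogeneous_in (t r - t' c) (U r c).

Lemma homogeneous_mx_mul k l h (t : 'I_k -> int) (t' : 'I_l -> int) (t'' : 'I_h -> int) U V :
  homogeneous_mx t t' U -> homogeneous_mx t' t'' V -> homogeneous_mx t t'' (U *m V).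
Proof.
move=> hU hV r c; rewrite mxE; apply: homogeneous_in_sum => j.
by apply: homogeneous_in_eq (homogeneous_inM (hU r j) (hV j c)); rewrite addrA subrK.
Qed.

(* Dropping from each entry of a solution the components of the wrong degree
   leaves a solution. *)
Lemma homogeneous_lift k l h (t : 'I_k -> int) (t' : 'I_l -> int) (t'' : 'I_h -> int)
    (U : 'M[Z]_(k, h)) (D : 'M[Z]_(l, h)) :
    homogeneous_mx t t'' U -> homogeneous_mx t' t'' D ->
    (forall r, exists v : 'rV_l, v *m D = row r U) ->
  exists2 V : 'M[Z]_(k, l), homogeneous_mx t t' V & V *m D = U.
Proof.
move=> hU hD /fin_all_exists[v vD].
have /fin_all_exists[w hw] : forall r, exists w : 'I_l -> Z, forall j,
    homogeneous_in (t r - t' j) (w j) /\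
    forall m, m \in msupp (v r 0 j - w j) -> (mdeg m)%:Z != t r - t' j.
  move=> r; have /fin_all_exists[w hw] j : exists q, homogeneous_in (t r - t' j) q /\
      forall m, m \in msupp (v r 0 j - q) -> (mdeg m)%:Z != t r - t' j.
    by have [q q1 q2] := homogeneous_split (t r - t' j) (v r 0 j); exists q.
  by exists w.
exists (\matrix_(r, j) w r j) => [r j|]; first by rewrite mxE; case: (hw r j).
apply/matrixP=> r c; apply/eqP; rewrite -subr_eq0 -msupp_eq0 -size_eq0 -leqn0 leqNgt.
rewrite -has_predT; apply/negP=> /hasP[m hm _].
have m1 : (mdeg m)%:Z = t r - t'' c.
  have: m \in msupp (U r c) ++ msupp ((\matrix_(r, j) w r j *m D) r c).
    by rewrite mem_cat orbC -mem_cat; apply: msuppB_le hm.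
  rewrite mem_cat => /orP[/hU//|]; rewrite mxE => /msupp_sum_le /flattenP[_ /mapP[j _ ->]].
  rewrite mxE => hj.
  by rewrite (homogeneous_inM (proj1 (hw r j)) (hD j c) hj) addrA subrK.
have /msupp_sum_le : m \in msupp (\sum_j (v r 0 j - w r j) * D j c).
  rewrite -(perm_mem (msuppN _)); congr (m \in msupp _): hm.
  have -> : U r c = (v r *m D) 0 c by rewrite vD mxE.
  by rewrite !mxE -sumrB -sumrN; apply: eq_bigr => j _; rewrite !mxE mulrBl opprB.
case/flattenP=> s /mapP[j _ ->] /msuppM_le /allpairsP[[m2 m3] /= [h2 h3 hm23]].
have {}h3 := hD _ _ _ h3.
have /eqP[] := proj2 (hw r j) _ h2.
by rewrite -[LHS](addrK (mdeg m3)%:Z) -PoszD -mdegD -hm23 m1 h3 opprB addrA subrK.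
Qed.

End Homogeneous.

(** Chain maps and homotopies are infinite families built one index at a time; [Q] is the invariant
    that makes the next choice possible. *)
Lemma dependent_choice (T : nat -> Type) (Q : forall i, T i -> Prop)
    (S : forall i, T i -> T i.+1 -> Prop) (x0 : T 0) :
    Q 0 x0 -> (forall i x, Q i x -> exists2 y, S i x y & Q i.+1 y) ->
  exists f : forall i, T i, f 0 = x0 /\ forall i, Q i (f i) /\ S i (f i) (f i.+1).
Proof.
move=> Q0 next.
have step i (x : {x : T i | Q i x}) : {y : {y : T i.+1 | Q i.+1 y} | S i (sval x) (sval y)}.
  apply: constructive_indefinite_description.
  by case: x => x Qx; have [y Sy Qy] := next i x Qx; exists (exist _ y Qy).
pose g := fix g i : {x : T i | Q i x} :=
  if i is j.+1 then sval (step j (g j)) else exist _ x0 Q0.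
exists (fun i => sval (g i)); split=> // i; split; first exact: svalP.
exact: (svalP (step i (g i))).
Qed.

(** * Comparison maps, homotopies and the computation of Tor *)

Section Augmented.
Variables (K : fieldType) (n : nat).
Notation Z := {mpoly K[n]}.
Implicit Types (F G : free_complex K n) (J : {pred Z}).

(* The augmented complex, in which [Z] sits at index 0 and [F_i] at index [i.+1]. *)
Definition arank F i := if i is i'.+1 then rk F i' else 1%N.

Definition adeg F i : 'I_(arank F i) -> int :=
  match i with 0 => fun=> 0 | i'.+1 => @dg _ _ F i' end.

Definition adif F i : 'M[Z]_(arank F i.+1, arank F i) :=
  match i with 0 => aug F | i'.+1 => dif F i' end.

Definition agraded F := forall i, homogeneous_mx (@adeg F i.+1) (@adeg F i) (adif F i).

Definition aexact F := forall i (u : 'rV_(arank F i.+1)),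
  u *m adif F i = 0 <-> exists v, v *m adif F i.+1 = u.

Definition aresolves F J := forall u : 'rV_1,
  u 0 0 \in J <-> exists v, v *m adif F 0 = u.

Lemma free_resolutionP J F :
  free_resolution J F <-> [/\ agraded F, aexact F & aresolves F J].
Proof.
split=> [[[h0 hS] hJ e0 eS]|[hg he hJ]].
  split=> [[|i] r c|[|i] u|u]; rewrite /= ?subr0 //.
    by rewrite [c]ord1; apply: h0.
  rewrite hJ; split=> -[v hv]; exists v; last by rewrite hv.
  by apply/rowP=> c; rewrite [c]ord1.
split; first split.
- by move=> c; have := hg 0 c 0; rewrite subr0.
- by move=> i; apply: (hg i.+1).
- move=> f; have := hJ f%:M; rewrite mxE eqxx mulr1n => ->; split=> -[v hv]; exists v.
    by rewrite hv mxE eqxx.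
  by apply/rowP=> c; rewrite [c]ord1 hv mxE eqxx.
- exact: (he 0).
- by move=> i; apply: (he i.+1).
Qed.

Lemma adif_adif F i : aexact F -> adif F i.+1 *m adif F i = 0.
Proof.
move=> he; apply/row_matrixP=> r; rewrite row_mul row0.
by apply/he; exists (delta_mx 0 r); rewrite -rowE.
Qed.

Definition chain_map F G (phi : forall i, 'M[Z]_(arank F i, arank G i)) :=
  forall i, phi i.+1 *m adif G i = adif F i *m phi i.

(** Comparison theorem, twisted by multiplication by [m]: the terms of [F] are free and [G] is
    exact. With [m = 1] it compares two resolutions of one ideal; with [m] a monomial it gives the
    map whose cone is taken. *)
Lemma chain_map_lift F G (J L : {pred Z}) (m : Z) (e : int) :
    free_resolution J F -> free_resolution L G -> homogeneous_in e m ->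
    (forall f, f \in J -> f * m \in L) ->
  exists phi : forall i, 'M[Z]_(arank F i, arank G i),
    [/\ phi 0 = m%:M, chain_map phi
      & forall i, homogeneous_mx (fun r => adeg r + e) (@adeg G i) (phi i)].
Proof.
move=> /free_resolutionP[gF eF rF] /free_resolutionP[gG eG rG] hm mJ.
(* The invariant puts the rows of the next right-hand side in the image of the differential of [G],
   so that [homogeneous_lift] applies. *)
pose Q i (phi : 'M[Z]_(arank F i, arank G i)) :=
  homogeneous_mx (fun r => adeg r + e) (@adeg G i) phi /\
  forall r, exists v, v *m adif G i = row r (adif F i *m phi).
have [||phi [phi0 phiP]] := @dependent_choice _ Q
  (fun i x y => y *m adif G i = adif F i *m x) m%:M.
- split=> [r c|r].
    by rewrite [r]ord1 [c]ord1 mxE eqxx mulr1n subr0 add0r.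
  apply/rG; rewrite mxE mul_mx_scalar mxE mulrC; apply: mJ.
  have <- : row r (aug F) 0 0 = aug F r 0 by rewrite mxE.
  by apply/rF; exists (delta_mx 0 r); rewrite -rowE.
- move=> i x [hx xr].
  have [|y hy Sy] := homogeneous_lift (t := fun r => adeg r + e) _ (gG i) xr.
    apply: homogeneous_mx_mul hx => r c; apply: homogeneous_in_eq (gF i r c).
    by rewrite opprD addrACA subrr addr0.
  exists y => //; split=> // r; apply/(eG i).
  by rewrite -row_mul -mulmxA Sy mulmxA adif_adif // mul0mx row0.
by exists phi; split=> // i; case: (phiP i) => [[]].
Qed.

Lemma null_homotopy F (J : {pred Z}) (th : forall i, 'M[Z]_(arank F i)) :
    free_resolution J F -> th 0 = 0 -> chain_map th ->
  exists h : forall i, 'M[Z]_(arank F i, arank F i.+1),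
    h 0 = 0 /\ forall i, th i.+1 = h i.+1 *m adif F i.+1 + adif F i *m h i.
Proof.
move=> /free_resolutionP[_ eF _] th0 thC.
(* Together with the chain map property, [Q] says that [th i.+1 - adif F i *m h] is killed by
   [adif F i], so exactness lifts its rows. *)
pose Q i (h : 'M[Z]_(arank F i, arank F i.+1)) :=
  adif F i *m th i = adif F i *m h *m adif F i.
have [||h [h0 hP]] := @dependent_choice _ Q
  (fun i x y => th i.+1 = y *m adif F i.+1 + adif F i *m x) 0.
- by rewrite /Q th0 !(mulmx0, mul0mx).
- move=> i x Qx.
  have [|y hy] := @fin_all_exists 'I_(arank F i.+1) (fun=> 'rV[Z]_(arank F i.+2))
    (fun r v => v *m adif F i.+1 = row r (th i.+1 - adif F i *m x)).
    by move=> r; apply/eF; rewrite -row_mul mulmxBl thC -Qx subrr row0.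
  have Sy : th i.+1 = (\matrix_r y r) *m adif F i.+1 + adif F i *m x.
    apply/eqP; rewrite -subr_eq; apply/eqP/row_matrixP=> r.
    by rewrite row_mul rowK hy.
  exists (\matrix_r y r) => //.
  by rewrite /Q Sy mulmxDr !mulmxA adif_adif // !mul0mx addr0.
by exists h; split=> // i; case: (hP i).
Qed.

Definition minimal_complex F := forall i, dif_K F i = 0.

Definition rank_in_degree F i (j : int) := #|[pred c | @dg _ _ F i c == j]|.

Lemma rank_degree_part F i j : \rank (degree_part F i j) = rank_in_degree F i j.
Proof.
pose P := [pred c | @dg _ _ F i c == j].
(* [B] keeps the nonzero rows of the diagonal matrix; its rows are distinct unit vectors, so its
   transpose is a right inverse. *)
pose B : 'M[K]_(#|P|, rk F i) := \matrix_(r < #|P|) delta_mx 0 (enum_val r).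
have -> : \rank (degree_part F i j) = \rank B.
  apply/eqmx_rank/andP; split; apply/row_subP=> r.
    rewrite row_diag_mx mxE; have [rj|_] := eqVneq; last by rewrite scale0r sub0mx.
    have rP : r \in P by rewrite inE rj.
    have <- : row (enum_rank_in rP r) B = delta_mx 0 r by rewrite rowK enum_rankK_in.
    by rewrite scale1r row_sub.
  rewrite rowK; have := enum_valP r; rewrite inE => rj.
  have <- : row (enum_val r) (degree_part F i j) = delta_mx 0 (enum_val r).
    by rewrite row_diag_mx mxE rj scale1r.
  exact: row_sub.
apply/eqP; change (row_free B); apply/row_freeP; exists B^T.
apply/matrixP=> r c; rewrite !mxE (bigD1 (enum_val r)) //= !mxE !eqxx mul1r big1 ?addr0.
  by rewrite (inj_eq enum_val_inj).
by move=> k kr; rewrite !mxE eqxx (negPf kr) mul0r.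
Qed.

Lemma degree_part_comm F G i j (U : 'M[Z]_(rk F i, rk G i)) :
    homogeneous_mx (@dg _ _ F i) (@dg _ _ G i) U ->
  degree_part F i j *m map_mx (mcoeff 0%MM) U =
  map_mx (mcoeff 0%MM) U *m degree_part G i j.
Proof.
move=> hU; apply/matrixP=> r c; rewrite mul_diag_mx mul_mx_diag !mxE.
have [e|ne] := eqVneq (@dg _ _ F i r - @dg _ _ G i c) 0.
  by move/subr0_eq: e => ->; rewrite mulrC.
by rewrite (homogeneous_in_mcoeff0 ne (hU r c)) mulr0 mul0r.
Qed.

Lemma chain_mapM F G H (phi : forall i, 'M[Z]_(arank F i, arank G i))
    (psi : forall i, 'M[Z]_(arank G i, arank H i)) :
  chain_map phi -> chain_map psi -> chain_map (fun i => phi i *m psi i).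
Proof. by move=> hphi hpsi i; rewrite -mulmxA hpsi !mulmxA hphi. Qed.

Lemma chain_mapB F G (phi psi : forall i, 'M[Z]_(arank F i, arank G i)) :
  chain_map phi -> chain_map psi -> chain_map (fun i => phi i - psi i).
Proof. by move=> hphi hpsi i; rewrite mulmxBl mulmxBr hphi hpsi. Qed.

(** Comparison maps in both directions are homotopy inverses. Modulo the variables the differentials
    of [G] vanish, so [P *m S] is the identity, and on cycles of [F] the map [S] kills exactly the
    boundaries. Rank-nullity for [S] on the cycles of degree [j] then gives the claim. *)
Lemma minimal_tor_dim F G J i j :
    free_resolution J F -> free_resolution J G -> minimal_complex G ->
  tor_dim F i j = rank_in_degree G i j.
Proof.
move=> hF hG Gmin.
have J1 f : f \in J -> f * 1 \in J by rewrite mulr1.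
have [phi [phi0 phiC phiH]] := chain_map_lift hG hF (@homogeneous_in1 K n) J1.
have [psi [psi0 psiC psiH]] := chain_map_lift hF hG (@homogeneous_in1 K n) J1.
have idC E : @chain_map E E (fun=> 1%:M) by move=> k; rewrite mul1mx mulmx1.
have [|h [h0 hE]] := null_homotopy hG _ (chain_mapB (chain_mapM phiC psiC) (idC G)).
  by rewrite phi0 psi0 mulmx1 subrr.
have [|g [g0 gE]] := null_homotopy hF _ (chain_mapB (chain_mapM psiC phiC) (idC F)).
  by rewrite phi0 psi0 mulmx1 subrr.
pose c0 k l (U : 'M[Z]_(k, l)) : 'M[K]_(k, l) := map_mx (mcoeff 0%MM) U.
have c0M k l m (U : 'M_(k, l)) (V : 'M_(l, m)) : c0 _ _ (U *m V) = c0 _ _ U *m c0 _ _ V.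
  exact: map_mxM.
have c0D k l (U V : 'M_(k, l)) : c0 _ _ (U + V) = c0 _ _ U + c0 _ _ V by exact: map_mxD.
have c0B k l (U V : 'M_(k, l)) : c0 _ _ (U - V) = c0 _ _ U - c0 _ _ V by exact: map_mxB.
have c01 k : c0 _ _ (1%:M : 'M_k) = 1%:M by exact: map_mx1.
have c00 k l : c0 _ _ (0 : 'M_(k, l)) = 0 by exact: map_mx0.
pose P := c0 _ _ (phi i.+1); pose S := c0 _ _ (psi i.+1).
pose V := degree_part F i j; pose W := (cycles_K F i :&: V)%MS.
have PV : degree_part G i j *m P = P *m V.
  by apply: degree_part_comm => r c; have := phiH i.+1 r c; rewrite addr0.
have SV : V *m S = S *m degree_part G i j.
  by apply: degree_part_comm => r c; have := psiH i.+1 r c; rewrite addr0.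
have dG k : c0 _ _ (dif G k) = 0 by exact: Gmin.
have PS : P *m S = 1%:M.
  apply/eqP; rewrite -subr_eq0 -c0M -c01 -c0B hE c0D !c0M /= dG mulmx0 add0r.
  by case: (i) => [|k]; rewrite ?h0 ?c00 ?mulmx0 //= dG mul0mx.
have BS : dif_K F i *m S = 0.
  by have := congr1 (c0 _ _) (psiC i.+1); rewrite !c0M /= dG mulmx0 => <-.
have BZ : (dif_K F i <= cycles_K F i)%MS.
  case: (i) => [|k]; rewrite ?submx1 //=; apply/sub_kermxP.
  have /free_resolutionP[_ eF _] := hF.
  by have := congr1 (c0 _ _) (adif_adif k.+1 eF); rewrite c0M c00.
have PZ : (P <= cycles_K F i)%MS.
  rewrite /P; case: (i) => [|k]; rewrite ?submx1 //=; apply/sub_kermxP.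
  by have := congr1 (c0 _ _) (phiC k.+1); rewrite !c0M /= dG mul0mx => <-.
(* In homological degree 0 every vector is a cycle and the augmentation need not kill it; there the
   term vanishes because [g 0 = 0]. *)
have Zg k l (U : 'M[K]_(l, _)) : (U <= cycles_K F k)%MS ->
    U *m c0 _ _ (adif F k) *m c0 _ _ (g k) = 0.
  case: k U => [|k] U; first by rewrite g0 c00 mulmx0.
  by move/sub_kermxP=> UZ; rewrite /c0 /= -/(dif_K F k) UZ mul0mx.
(* On a cycle killed by [S], the homotopy formula for [psi *m phi - 1] leaves only the boundary
   term. *)
have ZSP k (U : 'M[K]_(k, _)) : (U <= cycles_K F i)%MS -> U *m S = 0 -> (U <= dif_K F i)%MS.
  move=> UZ US; have := congr1 (mulmx U \o c0 _ _) (gE i).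
  rewrite /= c0B c01 c0D !c0M mulmxBr mulmx1 mulmxDr !mulmxA Zg // US !mul0mx sub0r addr0.
  by move/(canRL opprK) => ->; rewrite -mulNmx submxMl.
have WS : (W *m S :=: degree_part G i j)%MS.
  apply/eqmxP/andP; split.
    have /submxP[X ->] : (W <= V)%MS by apply: capmxSr.
    by rewrite -mulmxA SV mulmxA submxMl.
  rewrite -[degree_part G i j]mulmx1 -PS mulmxA submxMr // sub_capmx {2}PV submxMl andbT.
  exact: submx_trans (submxMl _ _) PZ.
have WK : (W :&: kermx S :=: dif_K F i :&: V)%MS.
  apply/eqmxP/andP; split; rewrite sub_capmx.
    rewrite ZSP /=; last by apply/sub_kermxP; apply: capmxSr.
      by apply: submx_trans (capmxSl _ _) (capmxSr _ _).
    by apply: submx_trans (capmxSl _ _) (capmxSl _ _).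
  rewrite capmxS //=; apply: submx_trans (capmxSl _ _) _; exact/sub_kermxP.
rewrite /tor_dim -/V -/W -(mxrank_mul_ker W S) WS WK addnK.
exact: rank_degree_part.
Qed.

End Augmented.

(** * Mapping cones and linear quotients *)

Section MappingCone.
Variables (K : fieldType) (n : nat).
Notation Z := {mpoly K[n]}.
Implicit Types (F G : free_complex K n) (J : {pred Z}).

(** The augmented [G] resolves Z/B when [G] resolves B. Its index 0 term, shifted by [e], becomes
    the basis element that maps to the new generator. *)
Definition mapping_cone F G (e : int) (phi : forall i, 'M[Z]_(arank G i, arank F i)) :=
  @FreeComplex K n
    (fun i => arank F i.+1 + arank G i)%N
    (fun i c => match split c with inl a => @adeg _ _ F i.+1 a | inr b => adeg b + e end)
    (fun i => block_mx (adif F i.+1) 0 (phi i.+1) (- adif G i))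
    (col_mx (adif F 0) (phi 0)).

(** Multiplication by [m] embeds Z/B in Z/A, since B is the colon ideal A : m, and the cokernel is
    Z/C. The cone over a lift of this injection is therefore exact. *)
Lemma cone_resolution F G e (phi : forall i, 'M[Z]_(arank G i, arank F i))
    (A B C : {pred Z}) m :
    free_resolution A F -> free_resolution B G ->
    (forall f, f * m \in A <-> f \in B) ->
    (forall f, f \in C <-> exists2 a, a \in A & exists g, f = a + g * m) ->
    phi 0 = m%:M -> @chain_map _ _ G F phi ->
    (forall i, homogeneous_mx (fun r => adeg r + e) (@adeg _ _ F i) (phi i)) ->
  free_resolution C (mapping_cone e phi).
Proof.
move=> /free_resolutionP[gF eF rF] /free_resolutionP[gG eG rG] AB hC phi0 phiC phiH.
(* Once the second component of a cycle is the boundary of [w], correcting the first one by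
   [w *m phi i.+1] makes it a cycle of [F]. *)
have lift i (x : 'rV_(arank F i.+1)) (y : 'rV_(arank G i)) w :
    x *m adif F i + y *m phi i = 0 -> w *m adif G i = y ->
    exists v, v *m dif (mapping_cone e phi) i = row_mx x y.
  move=> xy wy; have /eF[v hv] : (x + w *m phi i.+1) *m adif F i = 0.
    by rewrite mulmxDl -mulmxA phiC mulmxA wy.
  exists (row_mx v (- w)); rewrite mul_row_block hv mulNmx addrK mulmx0 add0r.
  by rewrite mulNmx mulmxN opprK wy.
apply/free_resolutionP; split.
- move=> [|i] r c /=.
    rewrite [c]ord1 -[r]splitK; case: (split r) => a; rewrite unsplitK.
      by rewrite col_mxEu; apply: gF.
    by rewrite col_mxEd; apply: (phiH 0).
  rewrite -[r]splitK -[c]splitK; case: (split r) (split c) => a [] b; rewrite !unsplitK.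
  + by rewrite block_mxEul; apply: (gF i.+1).
  + by rewrite block_mxEur mxE; apply: homogeneous_in0.
  + by rewrite block_mxEdl; apply: (phiH i.+1).
  rewrite block_mxEdr mxE; apply: homogeneous_inN.
  by apply: homogeneous_in_eq (gG i a b); rewrite opprD addrACA subrr addr0.
- have dd i : dif (mapping_cone e phi) i *m adif (mapping_cone e phi) i = 0.
    case: i => [|i].
      rewrite [adif _ 0]/= mul_block_col adif_adif // mul0mx addr0 phiC mulNmx subrr.
      exact: col_mx0.
    rewrite [LHS]mulmx_block (adif_adif i.+1 eF) phiC !mulNmx !mulmxN.
    rewrite (adif_adif i eG).
    by rewrite !(mul0mx, mulmx0, addr0, add0r, oppr0) subrr; apply: block_mx0.
  move=> i u; split=> [|[v <-]]; last by rewrite -mulmxA dd mulmx0.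
  rewrite -[u]hsubmxK; move: (lsubmx u) (rsubmx u) => x y; case: i u x y => [|i] _ x y /=.
    rewrite mul_row_col => xy; have [|w hw] := (rG y).1; last exact: lift hw.
    (* The colon condition enters here: the relation puts [y m] in A, hence [y] in B, the image of
       the augmentation of [G]. *)
    apply/AB; have -> : y 0 0 * m = (y *m phi 0) 0 0 by rewrite phi0 mul_mx_scalar mxE mulrC.
    by apply/rF; exists (- x); rewrite mulNmx; apply/eqP; rewrite eqr_oppLR -addr_eq0 xy.
  rewrite mul_row_block mulmx0 add0r mulmxN -row_mx0 => /eq_row_mx[xy] /eqP.
  by rewrite oppr_eq0 => /eqP/eG[w hw]; apply: lift hw.
- move=> u; rewrite hC /=; split=> [[a Aa [g ug]]|[v <-]].
    have [|v hv] := (rF a%:M).1; first by rewrite mxE eqxx.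
    exists (row_mx v g%:M); rewrite mul_row_col hv phi0 -scalar_mxM -raddfD -ug.
    by apply/rowP=> c; rewrite [c]ord1 mxE eqxx.
  rewrite -[v]hsubmxK; move: (lsubmx v) (rsubmx v) => x y; rewrite mul_row_col.
  exists ((x *m aug F) 0 0); first by apply/rF; exists x.
  by exists (y 0 0); rewrite mxE phi0 mul_mx_scalar [in RHS]mulrC; congr (_ + _); rewrite mxE.
Qed.

(** [graded_betti] quantifies over all resolutions; inductions carry one minimal resolution with
    known ranks instead. *)
Definition has_betti J (beta : nat -> int -> nat) := exists F,
  [/\ free_resolution J F, minimal_complex F
    & forall i j, rank_in_degree F i j = beta i j].

Lemma has_betti_graded J beta i j : has_betti J beta -> graded_betti J i j (beta i j).
Proof.
move=> [G [hG Gmin hb]]; split; first by exists G.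
by move=> F hF; rewrite -hb; apply: minimal_tor_dim hF hG Gmin.
Qed.

Lemma eq_has_betti J J' beta beta' : J =i J' -> beta =2 beta' ->
  has_betti J beta -> has_betti J' beta'.
Proof.
move=> eJ eb [F [[h0 hJ h1 h2] Fmin hF]]; exists F; split=> // [|i j]; last by rewrite hF eb.
by split=> // f; rewrite -eJ.
Qed.

(** The last two hypotheses make the cone minimal: the generators of B have nonzero degree, and the
    entries of the comparison map have positive degree, so none of them has a constant term. In the
    ranks, the index of [beta] drops by one because [G] enters augmented. *)
Lemma has_betti_cone (A B C : {pred Z}) alpha beta m (e : int) :
    has_betti A alpha -> has_betti B beta -> homogeneous_in e m ->
    (forall f, f * m \in A <-> f \in B) ->
    (forall f, f \in C <-> exists2 a, a \in A & exists g, f = a + g * m) ->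
    (forall j, 0 < beta 0 j -> j != 0)%N ->
    (forall i j j', 0 < alpha i j -> 0 < beta i j' -> (j < j' + e)%R)%N ->
  has_betti C (fun i j => alpha i j + if i is i'.+1 then beta i' (j - e)%R else e == j)%N.
Proof.
move=> [F [hF Fmin hFa]] [G [hG Gmin hGb]] hm AB hC b0 ab.
have [|phi [phi0 phiC phiH]] := chain_map_lift hG hF hm (J := B) (L := A).
  by move=> f /AB.
have rankP E i (c : 'I_(rk E i)) : (0 < rank_in_degree E i (@dg K n E i c))%N.
  by apply/card_gt0P; exists c; rewrite inE.
exists (mapping_cone e phi); split; first exact: cone_resolution hF hG _ _ _ _ _.
  move=> i; rewrite /dif_K /= map_block_mx map_mx0 map_mxN.
  have -> : map_mx (mcoeff 0%MM) (adif F i.+1) = 0 := Fmin i.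
  have -> : map_mx (mcoeff 0%MM) (phi i.+1) = 0.
    apply/matrixP=> r c; rewrite !mxE; apply: homogeneous_in_mcoeff0 (phiH i.+1 r c).
    by rewrite subr_eq0 eq_sym lt_eqF // (ab i) // -?hFa -?hGb rankP.
  have -> : map_mx (mcoeff 0%MM) (adif G i) = 0.
    case: i => [|i]; last exact: Gmin.
    have /free_resolutionP[gG _ _] := hG.
    apply/matrixP=> r c; rewrite !mxE; apply: homogeneous_in_mcoeff0 (gG 0 r c).
    by rewrite subr0 b0 // -hGb rankP.
  by rewrite oppr0; apply: block_mx0.
move=> i j; rewrite -hFa /rank_in_degree -sum1_card /= big_split_ord -!sum1_card /=.
congr addn.
  by apply: eq_bigl => c; rewrite !inE (unsplitK (inl c)).
case: i => [|i] /=.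
  rewrite big_mkcond big_ord_recl big_ord0 [LHS]addn0 inE (unsplitK (inr ord0)) /= add0r.
  by case: eqP.
rewrite -hGb /rank_in_degree -sum1_card; apply: eq_bigl => c.
rewrite !inE (unsplitK (inr c)) /=.
by rewrite -[RHS](inj_eq (addIr e)) subrK.
Qed.

End MappingCone.

(** * Betti numbers of monomial ideals with linear quotients *)

Section MonomialBetti.
Variables (K : fieldType) (n : nat).
Notation Z := {mpoly K[n]}.
Implicit Types (s : seq 'X_{1..n}) (a m t : 'X_{1..n}).

(** Testing membership on the support reduces colon ideals to divisibility of exponent vectors. *)
Definition mon_ideal s : {pred Z} :=
  fun f => all (fun m => has (fun a => (a <= m)%MM) s) (msupp f).

Lemma mon_idealP s (f : Z) :
  reflect {in msupp f, forall m, has (fun a => (a <= m)%MM) s} (f \in mon_ideal s).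
Proof. exact: allP. Qed.

Lemma mon_ideal_cons a s (f : Z) : f \in mon_ideal (a :: s) <->
  exists2 g, g \in mon_ideal s & exists h, f = g + h * 'X_[a].
Proof.
split=> [/mon_idealP fs|[g /mon_idealP gs [h ->]]]; last first.
  apply/mon_idealP=> m /msuppD_le; rewrite mem_cat => /orP[/gs /= ->|].
    by rewrite orbT.
  by rewrite (perm_mem (msuppMX _ _)) => /mapP[m' _ ->] /=; rewrite lem_addr.
pose P m := has (fun a => (a <= m)%MM) s.
exists (\sum_(m <- msupp f | P m) f@_m *: 'X_[m]).
  apply/mon_idealP=> m /msupp_sum_le /flattenP[s' /mapP[m']].
  by rewrite mem_filter => /andP[Pm' _] -> /msuppZ_le; rewrite msuppX inE => /eqP->.
exists (\sum_(m <- msupp f | ~~ P m) f@_m *: 'X_[m - a]).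
rewrite {1}(mpolyE f) (bigID P) /=; congr (_ + _); rewrite mulr_suml big_seq_cond.
rewrite [RHS]big_seq_cond; apply: eq_bigr => m /andP[/fs /=].
by rewrite -/(P m) => /orP[am _|-> //]; rewrite -scalerAl -mpolyXD submK.
Qed.

Lemma mon_ideal_colon a s s' :
    (forall t, has (fun c => (c <= a + t)%MM) s = has (fun c => (c <= t)%MM) s') ->
  forall f : Z, f * 'X_[a] \in mon_ideal s <-> f \in mon_ideal s'.
Proof.
move=> ss' f; split=> /mon_idealP fs; apply/mon_idealP=> m.
  by move=> fm; rewrite -ss'; apply: fs; rewrite (perm_mem (msuppMX _ _)) map_f.
by rewrite (perm_mem (msuppMX _ _)) => /mapP[t /fs ts ->]; rewrite ss'.
Qed.

Lemma has_betti_nil : has_betti (mon_ideal [::]) (fun _ _ => 0%N).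
Proof.
pose F := @FreeComplex K n (fun=> 0%N) (fun _ _ => 0) (fun=> 0) 0.
exists F; split=> [|i|i j].
- split=> [|f|u|i u]; first by split=> [[]|i []].
  + split=> [/mon_idealP f0|[u <-]].
      exists 0; rewrite mul0mx mxE; apply/esym/eqP; rewrite -msupp_eq0.
      by case: (msupp f) f0 => // m l /(_ m (mem_head _ _)).
    by rewrite mxE big_ord0; apply/mon_idealP=> m; rewrite msupp0.
  + by rewrite (thinmx0 u) mul0mx; split=> // _; exists 0; apply: mul0mx.
  + by rewrite (thinmx0 u) mul0mx; split=> // _; exists 0; apply: mul0mx.
- exact: map_mx0.
- by apply/eqP; rewrite -leqn0 (leq_trans (max_card _)) // card_ord.
Qed.

(** This is the Koszul complex. A new variable is a nonzerodivisor modulo the others, so the colon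
    ideal is the ideal already resolved, and the cone of that resolution with itself gives Pascal's
    rule. The index [i.+1] appears because the ideal is resolved, not its quotient ring. *)
Lemma has_betti_variables (x : seq 'I_n) : uniq x ->
  has_betti (mon_ideal [seq U_(k)%MM | k <- x])
    (fun i j => (j == i.+1) * 'C(size x, i.+1))%N.
Proof.
elim: x => [|k x IHx] /=.
  by move=> _; apply: eq_has_betti has_betti_nil => // i j; rewrite bin0n muln0.
case/andP=> kx /IHx{}IHx.
apply: eq_has_betti
  (has_betti_cone IHx IHx (homogeneous_inX (m := U_(k))) _ (mon_ideal_cons _ _) _ _).
- by [].
- move=> [|i] j; rewrite mdeg1.
    by rewrite !bin1 mulnS addnC [j == _]eq_sym; case: eqP.
  by rewrite subr_eq -PoszD addn1 (binS _ i.+1) mulnDr.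
- apply: mon_ideal_colon => t; rewrite !has_map; apply: eq_in_has => k' xk' /=.
  by rewrite !lep1mP mnmDE mnm1E; case: (eqVneq k k') => // kk'; rewrite -kk' (negPf kx) in xk'.
- by move=> j; case: eqP => // ->.
- by move=> i j j'; case: eqP => // ->; case: eqP => // ->; rewrite mdeg1 ltrDl.
Qed.

(* The generators are added from the right end of [s], so that [s2] consists of
   those that precede [x]. *)
Lemma has_betti_linear_quotients (T : eqType) (g : T -> 'X_{1..n}) (Q : T -> {set 'I_n})
    (s : seq T) :
    (forall (s1 : seq T) x (s2 : seq T), s = s1 ++ x :: s2 ->
       {in s2, forall y, mdeg (g y) <= mdeg (g x)}%N /\
       forall t, has (fun y => (g y <= g x + t)%MM) s2 = [exists k in Q x, t k != 0%N]) ->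
  has_betti (mon_ideal (map g s))
    (fun i j => \sum_(x <- s) (j == (i + mdeg (g x))%N) * 'C(#|Q x|, i))%N.
Proof.
elim: s => [|x s IHs] sQ.
  by apply: eq_has_betti has_betti_nil => // i j; rewrite big_nil.
have [gx Qx] := sQ [::] x s erefl.
have {}IHs : has_betti _ _ := IHs (fun (s1 : seq T) y (s2 : seq T) e =>
  sQ (x :: s1 : seq T) y s2 (congr1 (cons x) e)).
have xB := has_betti_variables (enum_uniq (Q x)).
apply: eq_has_betti
  (has_betti_cone IHs xB (homogeneous_inX (m := g x)) _ (mon_ideal_cons _ _) _ _).
- by [].
- move=> [|i] j; rewrite big_cons addnC; congr addn.
    by rewrite add0n bin0 muln1 eq_sym.
  by rewrite subr_eq -PoszD -cardE.
- apply: mon_ideal_colon => t; rewrite !has_map /preim /= Qx.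
  apply/exists_inP/hasP=> [[k kQ tk]|[k]].
    by exists k; rewrite ?mem_enum //= lep1mP.
  by rewrite mem_enum /= lep1mP; exists k.
- by move=> j; case: eqP => // ->.
(* Degrees in the complex built so far are [i + mdeg (g y)] with [y] earlier than [x]; the Koszul
   part contributes [i + 1 + mdeg (g x)], which is strictly larger. *)
- move=> i j j' a0; case: eqP => // -> _.
  have /hasP[y ys /eqP->] : has (fun y => j == (i + mdeg (g y))%N) s.
    apply: contraLR a0 => /hasPn js; rewrite lt0n negbK big_seq big1 // => y /js.
    by move/negPf->.
  by rewrite -PoszD ltz_nat addSn ltnS leq_add2l gx.
Qed.

End MonomialBetti.

(** * The colon ideals of a sparse symmetric shifted ideal *)

Section Tuples.
Variables s b : nat.
Local Open Scope nat_scope.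
Implicit Types (mu nu : s.-tuple 'I_b.+1) (i : 'I_s) (j : 'I_b).

Definition entry mu i : nat := tnth mu i.

Definition tuple_of (f : 'I_s -> nat) : s.-tuple 'I_b.+1 := [tuple inord (f i) | i < s].

Lemma entry_tuple_of f i : f i <= b -> entry (tuple_of f) i = f i.
Proof. by move=> fb; rewrite /entry tnth_mktuple inordK. Qed.

Lemma entry_le mu i : entry mu i <= b.
Proof. by rewrite -ltnS ltn_ord. Qed.

Lemma entry_inj mu nu : entry mu =1 entry nu -> mu = nu.
Proof. by move=> e; apply: eq_from_tnth => i; apply/val_inj/e. Qed.

Lemma entry_eq0P mu i : reflect (tnth mu i = ord0) (entry mu i == 0).
Proof. by rewrite /entry; apply: (iffP eqP) => [?|-> //]; apply: val_inj. Qed.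

Lemma le0P mu nu :
    (forall i, entry mu i <= entry nu i) ->
    (forall i, (entry mu i == 0) = (entry nu i == 0)) ->
  le0 mu nu.
Proof.
move=> le e0 i; split; first exact: le.
by split=> /entry_eq0P; [rewrite e0|rewrite -e0] => /entry_eq0P.
Qed.

Lemma eq_mxvec_index i i' j j' :
  (mxvec_index i j == mxvec_index i' j') = (i == i') && (j == j').
Proof.
have [g gK _] := curry_mxvec_bij s b.
by rewrite -xpair_eqE -(inj_eq (can_inj (in1T gK))).
Qed.

Lemma sparse_monE mu i j : sparse_mon mu (mxvec_index i j) = (entry mu i == j.+1).
Proof.
rewrite /sparse_mon mnm_sumE (bigD1 i) //= big1 => [|i' ii']; rewrite ?addn0.
  case: unliftP => [j' e|e]; rewrite /entry e ?mnm0E //.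
  by rewrite lift0 eqSS mnm1E eq_mxvec_index eqxx.
case: unlift => [j'|]; last by rewrite mnm0E.
by rewrite mnm1E eq_mxvec_index (negPf ii').
Qed.

Lemma sparse_monP mu (t : 'X_{1..s * b}) : reflect
  (forall i j, entry mu i = j.+1 -> t (mxvec_index i j) != 0) (sparse_mon mu <= t)%MM.
Proof.
apply: (iffP mnm_lepP) => h => [i j e|k].
  by have := h (mxvec_index i j); rewrite sparse_monE e eqxx lt0n.
case/mxvec_indexP: k => i j; rewrite sparse_monE.
by case: eqP => // /h; rewrite lt0n.
Qed.

Lemma sparse_mon_le mu nu : reflect
  (forall i, entry mu i != 0 -> entry mu i = entry nu i) (sparse_mon mu <= sparse_mon nu)%MM.
Proof.
apply: (iffP (sparse_monP _ _)) => h i => [|j e]; last first.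
  by rewrite sparse_monE -h e ?eqxx.
have := entry_le mu i; case e: (entry mu i) => [|j] // jb _.
by have := h i (Ordinal jb) e; rewrite sparse_monE eqb0 negbK => /eqP.
Qed.

Lemma sparse_mon_inj : injective (@sparse_mon s b).
Proof.
move=> mu nu e; apply: entry_inj => i.
have /sparse_mon_le/(_ i) h1 : (sparse_mon mu <= sparse_mon nu)%MM by rewrite e lepm_refl.
have /sparse_mon_le/(_ i) h2 : (sparse_mon nu <= sparse_mon mu)%MM by rewrite e lepm_refl.
case: (eqVneq (entry mu i) 0) => [z|/h1 //].
by case: (eqVneq (entry nu i) 0) => [-> //|/h2 ->].
Qed.

Lemma mdeg_sparse_mon mu : mdeg (sparse_mon mu) = \sum_i (entry mu i != 0).
Proof.
rewrite /sparse_mon mdeg_sum; apply: eq_bigr => i _; rewrite /entry.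
by case: unliftP => [j ->|->]; rewrite ?mdeg1 ?mdeg0.
Qed.

Definition permute mu (a : 'S_s) : s.-tuple 'I_b.+1 := [tuple tnth mu (a i) | i < s].

Lemma entry_permute mu a i : entry (permute mu a) i = entry mu (a i).
Proof. by rewrite /entry tnth_mktuple. Qed.

(** For [i' = i] the first test wins and the entry is replaced in place, so lowering and moving an
    entry are one operation. *)
Definition move_entry mu i i' v :=
  tuple_of (fun k => if k == i then v else if k == i' then 0 else entry mu k).

Lemma entry_move mu i i' v k : v <= b -> entry (move_entry mu i i' v) k =
  if k == i then v else if k == i' then 0 else entry mu k.
Proof. by move=> vb; rewrite entry_tuple_of //; do 2?case: ifP => // _; apply: entry_le. Qed.

(* [position_weight] orders the pairs (value, position) with nonzero value
   lexicographically; the additive constant makes [weight] compare degrees first. *)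
Definition position_weight v i := if v == 0 then 0 else b.+1 * s * s + v * s + i.

Definition weight mu := \sum_i position_weight (entry mu i) i.

Lemma position_weight0 i : position_weight 0 i = 0.
Proof. by []. Qed.

Lemma position_weightE v i : v != 0 -> position_weight v i = b.+1 * s * s + (v * s + i).
Proof. by rewrite /position_weight addnA => /negPf->. Qed.

Lemma position_weight_gt0 v i i' w :
  position_weight w i' < position_weight v i -> v != 0.
Proof. by case: v. Qed.

Lemma position_weight_lt v w i i' :
  v != 0 -> position_weight v i < position_weight w i' -> v <= w.
Proof.
move=> v0 lt; have w0 := position_weight_gt0 lt; move: lt.
rewrite !position_weightE // ltn_add2l; apply: contraTT; rewrite -ltnNge -leqNgt => wv.
have := ltn_ord i'; have : w.+1 * s <= v * s by rewrite leq_mul2r wv orbT.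
by rewrite mulSn; lia.
Qed.

Lemma position_weight_le v w i :
  (position_weight v i <= position_weight w i) = (v <= w).
Proof.
have sgt0 := leq_ltn_trans (leq0n i) (ltn_ord i).
have [->|v0] := eqVneq v 0; first by [].
have [->|w0] := eqVneq w 0.
  rewrite position_weight0 position_weightE // !leqn0 (negPf v0); apply/negbTE.
  by rewrite -lt0n addn_gt0 !muln_gt0 sgt0.
by rewrite !position_weightE // leq_add2l leq_add2r leq_pmul2r.
Qed.

Lemma position_weight_inj v w i i' : v != 0 -> w != 0 ->
  position_weight v i = position_weight w i' -> i = i'.
Proof.
move=> v0 w0; rewrite !position_weightE // => /addnI.
by move/(congr1 (modn^~ s)); rewrite !modnMDl !modn_small // => /val_inj.
Qed.

(** Each lexicographic term [v * s + i] is less than [b.+1 * s], so the [s] of them add up to less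
    than the constant [c]. A tuple of degree [d] thus has weight at least [c * d] and less than
    [c * d + c]. *)
Lemma weight_mdeg mu nu : weight nu <= weight mu ->
  mdeg (sparse_mon nu) <= mdeg (sparse_mon mu).
Proof.
rewrite !mdeg_sparse_mon.
pose c := b.+1 * s * s; pose d mu := \sum_i (entry mu i != 0).
have lo : c * d nu <= weight nu.
  rewrite big_distrr; apply: leq_sum => i _ /=; rewrite /position_weight.
  by case: eqP => _ /=; rewrite ?muln0 // muln1 -addnA leq_addr.
have [s0|s0] := posnP s.
  rewrite !big1 // => i; have := leq_ltn_trans (leq0n i) (ltn_ord i);
    by rewrite lt0n => /eqP/(_ s0).
have hi : weight mu < c * d mu + c.
  have : weight mu <= c * d mu + \sum_(i < s) (b.+1 * s).-1.
    rewrite big_distrr -big_split; apply: leq_sum => i _ /=; rewrite /position_weight.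
    case: eqP => _ //=; rewrite muln1 -addnA leq_add2l.
    have := ltn_ord i; have : entry mu i * s <= b * s by rewrite leq_mul2r entry_le orbT.
    by rewrite mulSn; lia.
  rewrite sum_nat_const card_ord => /leq_ltn_trans; apply.
  by rewrite ltn_add2l mulnC ltn_pmul2r // prednK // muln_gt0.
move=> le; rewrite -ltnS -/(d nu) -/(d mu).
have c0 : 0 < c by rewrite !muln_gt0 s0.
rewrite -(ltn_pmul2l c0) mulnS addnC; exact: leq_ltn_trans (leq_trans lo le) hi.
Qed.

Lemma weight_le_sub mu nu : (sparse_mon mu <= sparse_mon nu)%MM -> weight mu <= weight nu.
Proof.
move/sparse_mon_le=> h; apply: leq_sum => i _.
by case: (eqVneq (entry mu i) 0) => [->|/h->].
Qed.

Lemma weight_move mu i i' v : v <= b -> (i' == i) || (entry mu i == 0) ->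
  position_weight v i < position_weight (entry mu i') i' ->
  weight (move_entry mu i i' v) < weight mu.
Proof.
move=> vb ii' lt; rewrite /weight (bigD1 i) // [ltnRHS](bigD1 i) //= entry_move // eqxx.
move: ii'; have [e|ne] := eqVneq i' i => /= [_|/eqP z].
  rewrite e in lt *; rewrite -addSn leq_add //; apply/eq_leq/eq_bigr=> k ki.
  by rewrite entry_move // (negPf ki).
rewrite z (bigD1 i') // [ltnRHS](bigD1 i') //= entry_move // eqxx (negPf ne) !add0n.
rewrite -addSn leq_add //; apply/eq_leq/eq_bigr=> k /andP[ki ki'].
by rewrite entry_move // (negPf ki) (negPf ki').
Qed.

End Tuples.

(** * Moves and exchanges among the minimal generators *)

Section SymmetricShifted.
Variables (K : fieldType) (s b : nat) (J : {pred {mpoly K[s * b]}}).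
Hypothesis hJ : sparse_symmetric_shifted J.
Notation Z := {mpoly K[s * b]}.
Implicit Types (mu nu : s.-tuple 'I_b.+1) (m : 'X_{1..s * b}) (i : 'I_s) (j : 'I_b).

Definition in_gens mu := sparse_mon mu \in mingens J.

Lemma ideal_mul (f g : Z) : g \in J -> f * g \in J.
Proof.
have [J0 _ JD] := sss_ideal hJ.
by move=> gJ; have := JD f _ _ gJ J0; rewrite addr0.
Qed.

Lemma ideal_sum (I : eqType) (r : seq I) (F : I -> Z) :
  {in r, forall x, F x \in J} -> \sum_(x <- r) F x \in J.
Proof.
have [J0 _ JD] := sss_ideal hJ.
elim: r => [|x r IHr] h; first by rewrite big_nil.
rewrite big_cons -[F x]mul1r; apply: JD; first exact: h (mem_head _ _).
by apply: IHr => y yr; apply: h; rewrite inE yr orbT.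
Qed.

Lemma ideal_monomial_le m m' : (m <= m')%MM -> 'X_[m] \in J -> 'X_[m'] \in J.
Proof. by move=> mm' mJ; rewrite -(submK mm') mpolyXD; apply: ideal_mul. Qed.

Lemma sparse_dvd (f : Z) m : f \in J -> m \in msupp f ->
  exists2 mu, 'X_[sparse_mon mu] \in J & (sparse_mon mu <= m)%MM.
Proof.
have [A hA] := sss_sparse hJ.
case/hA=> r rA -> /msupp_sum_le /flattenP[l /mapP[x]].
rewrite mem_filter /= => xr ->; rewrite (perm_mem (msuppMX _ _)) => /mapP[m' _ ->].
have [mu Amu e] := rA x xr; exists mu; last by rewrite e lem_addr.
apply/hA; exists [:: (1, sparse_mon mu)] => [y|]; last by rewrite big_seq1 mul1r.
by rewrite inE => /eqP->; exists mu.
Qed.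

Lemma mingensP m : reflect
  ('X_[m] \in J /\ forall m', 'X_[m'] \in J -> (m' <= m)%MM -> m' = m) (m \in mingens J).
Proof.
apply: (iffP andP) => -[mJ h]; split=> //.
  move=> m' m'J m'm; have m'd : (mdeg m' < (mdeg m).+1)%N.
    by rewrite ltnS -(submK m'm) mdegD leq_addl.
  by have /forallP/(_ (BMultinom m'd)) := h; rewrite /= m'J m'm => /eqP.
by apply/forallP=> m'; apply/implyP=> /andP[m'J /(h _ m'J)->].
Qed.

Lemma gens_dvd m : 'X_[m] \in J -> exists2 mu, in_gens mu & (sparse_mon mu <= m)%MM.
Proof.
elim/ltn_ind: {m}(mdeg m) {-2}m (erefl (mdeg m)) => d IHd m dm mJ.
have mm : m \in msupp ('X_[m] : Z) by rewrite msuppX inE.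
have [mu muJ mum] := sparse_dvd mJ mm.
have [|] := boolP (in_gens mu); first by exists mu.
rewrite /in_gens [_ \in mingens J]/(_ && _) muJ => /forallPn[m'].
rewrite negb_imply => /andP[/andP[m'J m'mu] ne].
have lt : (mdeg m' < d)%N.
  rewrite -dm -(submK (lepm_trans m'mu mum)) mdegD -[ltnLHS]add0n ltn_add2r lt0n mdeg_eq0.
  apply: contra ne => /eqP z; move: (submK (lepm_trans m'mu mum)); rewrite z add0m => e.
  by apply/eqP/mnmP=> k; apply/eqP; rewrite eqn_leq; move/mnm_lepP: m'mu => ->;
     rewrite e; move/mnm_lepP: mum => ->.
have [nu nuG num'] := IHd _ lt m' erefl m'J.
by exists nu => //; apply: lepm_trans num' (lepm_trans m'mu mum).
Qed.

Lemma gens_in_ideal mu : in_gens mu -> 'X_[sparse_mon mu] \in J.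
Proof. by case/andP. Qed.

Lemma mon_ideal_gens (l : seq (s.-tuple 'I_b.+1)) : l =i in_gens ->
  @mon_ideal K _ [seq sparse_mon mu | mu <- l] =i J.
Proof.
move=> lG f; apply/mon_idealP/idP => [h|fJ m fm]; last first.
  have [mu muJ mum] := sparse_dvd fJ fm.
  have [nu nuG nmu] := gens_dvd muJ.
  apply/hasP; exists (sparse_mon nu); last exact: lepm_trans nmu mum.
  by apply: map_f; rewrite lG.
rewrite (mpolyE f); apply: ideal_sum => m /h/hasP[_ /mapP[mu muG ->] mum].
rewrite -mul_mpolyC; apply: ideal_mul; apply: ideal_monomial_le mum _; apply: gens_in_ideal.
by rewrite lG in muG.
Qed.

(** This extends (S-2) from minimal generators to all sparse monomials of J: a minimal generator
    dividing z^mu is lowered to agree with [nu] on its support, and the result divides z^nu. *)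
Lemma ideal_shift mu nu : (forall i, entry nu i <= entry mu i)%N ->
    (forall i, (entry nu i == 0%N) = (entry mu i == 0%N)) ->
  'X_[sparse_mon mu] \in J -> 'X_[sparse_mon nu] \in J.
Proof.
move=> le e0 muJ; have [mu0 mu0G /sparse_mon_le mu0mu] := gens_dvd muJ.
pose nu0 : s.-tuple 'I_b.+1 :=
  tuple_of b (fun i => if entry mu0 i == 0%N then 0%N else entry nu i).
have nu0E i : entry nu0 i = if entry mu0 i == 0%N then 0%N else entry nu i.
  by rewrite entry_tuple_of //; case: ifP => // _; apply: entry_le.
apply: (@ideal_monomial_le (sparse_mon nu0)).
  by apply/sparse_mon_le=> i; rewrite nu0E; case: ifP.
apply: (sss_shifted hJ mu0G); apply: le0P => i; rewrite nu0E.
  by have [|/mu0mu->] := eqVneq (entry mu0 i) 0%N.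
by have [_|h] := eqVneq (entry mu0 i) 0%N; rewrite // e0 -mu0mu // (negPf h).
Qed.

(** The inverse appears because [sigma] carries the entry at [i] to position [sigma i], whereas
    [permute] reads position [i] from its image. *)
Lemma sym_actX (sigma : 'S_s) mu :
  sym_act sigma ('X_[sparse_mon mu] : Z) =
  'X_[sparse_mon (permute mu sigma^-1)].
Proof.
have XS (F : 'I_s -> 'X_{1..s * b}) : 'X_[\sum_i F i] = \prod_i 'X_[F i] :> Z.
  by apply: (big_morph _ (@mpolyXD _ _)); rewrite mpolyX0.
rewrite /sparse_mon !XS /sym_act rmorph_prod /= [RHS](reindex_inj (@perm_inj _ sigma)).
apply: eq_bigr => i _; rewrite tnth_mktuple permK; case: unlift => [j|].
  by rewrite comp_mpolyXU -tnth_nth tnth_mktuple mxvecE mxE.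
by rewrite mpolyX0 rmorph1.
Qed.

Lemma ideal_permute (sigma : 'S_s) mu : 'X_[sparse_mon mu] \in J ->
  'X_[sparse_mon (permute mu sigma)] \in J.
Proof.
move=> muJ; have := sss_symmetric hJ (sigma^-1)%g muJ.
by rewrite sym_actX invgK.
Qed.

(** The transposition of [i] and [i'], allowed by (S-3), brings the entry of [i'] to [i], where
    (S-2) lowers it to [v]. *)
Lemma ideal_move_entry mu i i' v : 'X_[sparse_mon mu] \in J -> v != 0%N ->
    (i' == i) || (entry mu i == 0%N) -> (v <= entry mu i')%N ->
  'X_[sparse_mon (move_entry mu i i' v)] \in J.
Proof.
move=> muJ v0 ii' le; have vb := leq_trans le (entry_le _ _).
apply: ideal_shift (ideal_permute (tperm i i') muJ) => k; rewrite entry_move // entry_permute;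
  have [->|ki] := eqVneq k i; rewrite ?tpermL //.
- have [->|ki'] := eqVneq k i'; first by [].
  by rewrite tpermD // eq_sym.
- rewrite (negPf v0); apply/esym/negbTE; rewrite -lt0n; apply: leq_trans le.
  by rewrite lt0n.
have [e|ki'] := eqVneq k i'; last by rewrite tpermD // eq_sym.
by move: ii'; rewrite e tpermR -e (negPf ki) => /= ->.
Qed.

(* As in [mxvec_index], the pair [(i, j)] stands for the variable z_{i,j+1}. *)
Definition colon_set mu : {set 'I_(s * b)} :=
  [set mxvec_index p.1 p.2 | p in [set p : 'I_s * 'I_b |
     [exists i', ((i' == p.1) || (entry mu p.1 == 0%N)) &&
       (position_weight b p.2.+1 p.1 < position_weight b (entry mu i') i')%N]]].

(** The moved monomial divides z^mu times the variable [k]. A minimal generator dividing it weighs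
    no more than it does, hence less than [mu]. *)
Lemma colon_set_sub mu k : in_gens mu -> k \in colon_set mu ->
  exists nu, [/\ in_gens nu, (weight nu < weight mu)%N
    & forall t : 'X_{1..s * b}, t k != 0%N -> (sparse_mon nu <= sparse_mon mu + t)%MM].
Proof.
move=> muG /imsetP[[i j]]; rewrite inE => /existsP[i' /andP[/= ii' lt]] ->.
have jle : (j.+1 <= b)%N := ltn_ord j.
have jn0 : j.+1 != 0%N by [].
have := ideal_move_entry (gens_in_ideal muG) jn0 ii' (position_weight_lt jn0 lt).
case/gens_dvd=> nu nuG num; exists nu; split=> //.
  exact: leq_ltn_trans (weight_le_sub num) (weight_move jle ii' lt).
move=> t tk; apply: lepm_trans num _; apply/sparse_monP=> i0 j0.
rewrite entry_move // mnmDE addn_eq0 negb_and sparse_monE.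
have [->|_] := eqVneq i0 i; first by case=> /val_inj <-; rewrite tk orbT.
by case: eqP => // _ ->; rewrite eqxx.
Qed.

(* [nu] satisfies the hypothesis on the weights as soon as no variable of
   [colon_set mu] divides z^nu / gcd(z^nu, z^mu).  Replacing an entry of [nu] at a
   zero of [mu] by an entry of [mu] at a zero of [nu] decreases [weight nu], until
   the support of [nu] lies in that of [mu]. *)
Lemma weight_gens_lt mu nu : in_gens mu -> 'X_[sparse_mon nu] \in J ->
    (mdeg (sparse_mon nu) <= mdeg (sparse_mon mu))%N ->
    (forall i i', entry nu i != 0%N -> (i' == i) || (entry mu i == 0%N) ->
      (position_weight b (entry mu i') i' <= position_weight b (entry nu i) i)%N) ->
  nu != mu -> (weight mu < weight nu)%N.
Proof.
move=> muG.
elim/ltn_ind: {nu}(weight nu) {-2}nu (erefl (weight nu)) => w IHw nu wnu nuJ dnu H ne.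
have [/existsP[i /andP[nui /eqP mui]]|] :=
  boolP [exists i, (entry nu i != 0%N) && (entry mu i == 0%N)]; last first.
  rewrite negb_exists => /forallP sub.
  have nu0 i : entry nu i != 0%N -> entry mu i != 0%N by have := sub i; case: eqP.
  have le i : entry nu i != 0%N -> (entry mu i <= entry nu i)%N.
    by move=> nui; rewrite -(@position_weight_le s b _ _ i) H ?eqxx.
  (* Lowering [nu] to the entries of [mu] on its support gives a divisor of z^mu that lies in J; by
     minimality it is z^mu, so the supports agree. *)
  pose nu' : s.-tuple 'I_b.+1 :=
    tuple_of b (fun i => if entry nu i == 0%N then 0%N else entry mu i).
  have nu'E i : entry nu' i = if entry nu i == 0%N then 0%N else entry mu i.
    by rewrite entry_tuple_of //; case: ifP => // _; apply: entry_le.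
  have nu'J : 'X_[sparse_mon nu'] \in J.
    apply: ideal_shift nuJ => i; rewrite nu'E; have [//|h] := eqVneq (entry nu i) 0%N.
      exact: le.
    exact/negbTE/nu0.
  have /mingensP[_ /(_ _ nu'J)/(_ _)/sparse_mon_inj e] := muG.
  have {}e : nu' = mu by apply: e; apply/sparse_mon_le=> i; rewrite nu'E; case: ifP.
  have {}le i : (entry mu i <= entry nu i)%N.
    by have [z|/le//] := eqVneq (entry nu i) 0%N; rewrite -e nu'E z.
  have [i ltm] : exists i, (entry mu i < entry nu i)%N.
    apply/existsP; apply: contraR ne; rewrite negb_exists => /forallP h.
    by apply/eqP/entry_inj => i; apply/eqP; rewrite eqn_leq le leqNgt h.
  rewrite /weight (bigD1 i) // [ltnRHS](bigD1 i) //= -addSn leq_add //.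
    by rewrite ltnNge position_weight_le -ltnNge.
  by apply: leq_sum => k _; rewrite position_weight_le.
(* Since the degree of z^nu is at most that of z^mu, the extra position [i] in the support of [nu]
   is compensated by a missing one. *)
have [i' /andP[mui' /eqP nui']] :
    exists i', (entry mu i' != 0%N) && (entry nu i' == 0%N).
  apply/existsP; apply: contraLR dnu; rewrite negb_exists => /forallP sub.
  rewrite -ltnNge !mdeg_sparse_mon (bigD1 i) // [ltnRHS](bigD1 i) //= nui mui.
  rewrite add0n add1n ltnS; apply: leq_sum => k _.
  by have := sub k; case: eqP => //= _; case: eqP.
have ii' : i' != i by apply: contraNneq nui => <-; rewrite nui'.
have le := H i i' nui; rewrite mui orbT in le; have {}le := le isT.
have lt : (position_weight b (entry mu i') i' < position_weight b (entry nu i) i)%N.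
  rewrite ltn_neqAle le andbT; apply: contra ii' => /eqP e.
  by apply/eqP; apply: position_weight_inj e.
have vle := position_weight_lt mui' lt.
have vb := entry_le mu i'.
pose nu' := move_entry nu i' i (entry mu i').
have nu'E k : entry nu' k = if k == i' then entry mu i' else if k == i then 0%N else entry nu k.
  exact: entry_move.
have nu'J : 'X_[sparse_mon nu'] \in J by apply: ideal_move_entry; rewrite ?nui' ?orbT.
have lt' : (weight nu' < weight nu)%N by apply: weight_move; rewrite ?nui' ?orbT.
have [e|ne'] := eqVneq nu' mu; first by rewrite -e.
apply: ltn_trans (lt'); apply: (IHw (weight nu') _ nu') => //; first by rewrite -wnu.
- apply: leq_trans dnu; rewrite !mdeg_sparse_mon.
  rewrite (bigD1 i') // [leqRHS](bigD1 i') //=.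
  rewrite (bigD1 i) 1?eq_sym //= [X in (_ <= _ + X)%N](bigD1 i) 1?eq_sym //=.
  rewrite !nu'E !eqxx (eq_sym i) (negPf ii') mui' nui nui' /= add0n leq_add2l.
  by apply: leq_sum => k /andP[ki' ki]; rewrite nu'E (negPf ki) (negPf ki').
move=> k k'; rewrite nu'E; have [-> _|ki'] := eqVneq k i'.
  by rewrite (negPf mui') orbF => /eqP->.
by have [//|ki] := eqVneq k i; apply: H.
Qed.

End SymmetricShifted.

(** * Counting rearrangements *)

Section PermutationCounting.
Local Open Scope nat_scope.

(* Build the stabilizer of [f] one fiber at a time: fixing the points outside the
   fibers over [v :: W], it is the product of the symmetric group of the fiber
   over [v] and the group for [W]. *)
Lemma card_perm_fibers (T V : finType) (f : T -> V) :
  #|[set a : {perm T} | [forall x, f (a x) == f x]]| = \prod_v #|[set x | f x == v]|`!.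
Proof.
pose G (W : seq V) := [set a : {perm T} |
  [forall x, (f (a x) == f x) && ((f x \in W) || (a x == x))]].
have GP W (a : {perm T}) :
    reflect (forall x, f (a x) = f x /\ (f x \notin W -> a x = x)) (a \in G W).
  rewrite inE; apply: (iffP forallP) => h x; have := h x.
    by case/andP=> /eqP-> /orP[->//|/eqP->].
  by case=> -> ax; rewrite eqxx /=; case: (boolP (f x \in W)) => //= /ax ->.
suff cG W : uniq W -> #|G W| = \prod_(v <- W) #|[set x | f x == v]|`!.
  rewrite -(cG _ (index_enum_uniq V)); apply: eq_card => a; rewrite !inE.
  by apply: eq_forallb => x; rewrite mem_index_enum andbT.
elim: W => [_|v W IHW /andP[vW /IHW{}IHW]].
  rewrite big_nil -(cards1 (1%g : {perm T})); apply: eq_card => a; rewrite inE.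
  apply/GP/eqP=> [h|-> x]; last by rewrite perm1.
  by apply/permP=> x; rewrite perm1; apply: (h x).2.
pose A := [set x | f x == v].
have fA a x : perm_on A a -> f (a x) = f x.
  move=> aA; have [xA|xA] := boolP (x \in A); last by rewrite (out_perm aA xA).
  by move: (xA); rewrite -(perm_closed x aA); move: xA; rewrite !inE => /eqP-> /eqP->.
have WA a x : a \in G W -> x \in A -> a x = x.
  by move=> /GP/(_ x)[_ h] xA; apply: h; move: xA; rewrite inE => /eqP->.
pose SA := [set a : {perm T} | perm_on A a].
have cA : #|SA| = #|A|`! by rewrite cardsE card_perm.
rewrite big_cons -IHW -cA -cardsX; apply/esym.
pose m (p : {perm T} * {perm T}) := (p.1 * p.2)%g.
have minj : {in setX SA (G W) &, injective m}.
  move=> [a c] [a' c'] /setXP[/= + cW] /setXP[/= + cW']; rewrite !inE => aA aA' e.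
  have {}aa' : a = a'.
    apply/permP=> x; have [xA|xA] := boolP (x \in A); last by rewrite !(out_perm _ xA).
    have := congr1 (fun b : {perm T} => b x) e; rewrite !permM.
    by rewrite (WA _ _ cW) ?perm_closed // (WA _ _ cW') ?perm_closed.
  by move: e; rewrite /m /= aa' => /mulgI->.
rewrite -(card_in_imset minj); apply: eq_card => a.
apply/imsetP/GP => [[[a1 a2] /setXP[/= +]] + ->|h].
  rewrite inE => aA aW x; rewrite /m permM /=; have /GP/(_ (a1 x))[-> h] := aW.
  split; first exact: fA.
  rewrite inE negb_or => /andP[xv xW].
  by rewrite h ?fA // (out_perm aA) // inE.
have aN : a \in ('N(A | 'P))%g.
  by apply/astabsP => x; rewrite /= apermE !inE (h x).1.
(* Since [a] preserves the fiber [A], it factors as its restriction to [A] followed by a permutation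
   fixing [A] pointwise. *)
pose a1 := restr_perm A a.
have a1A : perm_on A a1 := restr_perm_on A a.
exists (a1, (a1^-1 * a)%g); last by rewrite /m /= mulKVg.
apply/setXP; split; first by rewrite inE.
apply/GP=> x; rewrite permM.
have xE : a1 ((a1^-1)%g x) = x by rewrite permKV.
rewrite (h _).1; split; first by rewrite -(fA _ _ a1A) xE.
move=> xW; have [xA|xA] := boolP (x \in A).
  have yA : (a1^-1)%g x \in A by rewrite -(perm_closed _ a1A) xE.
  by rewrite -(restr_permE aN yA) xE.
have -> : (a1^-1)%g x = x by rewrite (out_perm (perm_onV a1A)).
by apply: (h x).2; rewrite inE negb_or xW andbT; rewrite inE in xA.
Qed.

Section Argmax.
Variables (n : nat) (A : {set 'I_n}).

Lemma perm_argmax (a : 'S_n) : A != set0 ->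
  exists2 x, x \in A & forall y, (y \in A) && [forall z in A, a z <= a y] = (y == x).
Proof.
case/set0Pn=> x0 x0A; pose x := [arg max_(y > x0 in A) (a y : nat)].
have [xA xm] : x \in A /\ forall y, y \in A -> a y <= a x.
  by rewrite /x; case: arg_maxnP => // y yA h; split=> // z /h.
exists x => // y; apply/andP/eqP=> [[yA /forall_inP/(_ x xA) h]|->].
  by apply/(@perm_inj _ a)/val_inj/eqP; rewrite eqn_leq h xm.
by split=> //; apply/forall_inP.
Qed.

(* By symmetry every element of [A] is equally likely to have the largest image. *)
Lemma card_perm_argmax (B : {set 'I_n}) : A != set0 -> B \subset A ->
  #|[set a : 'S_n | [exists x in B, [forall z in A, a z <= a x]]]| * #|A| = #|B| * n`!.
Proof.
move=> A0 BA; pose E x := [set a : 'S_n | [forall z in A, a z <= a x]].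
(* Multiplication by the transposition of [x] and [y], which preserves [A], injects [E x] into
   [E y]. *)
have EE x y : x \in A -> y \in A -> #|E x| <= #|E y|.
  move=> xA yA; rewrite -(card_imset _ (mulgI (tperm x y))); apply/subset_leq_card.
  apply/subsetP=> _ /imsetP[a + ->]; rewrite !inE => /forall_inP h.
  apply/forall_inP=> z zA; rewrite !permM tpermR; apply: h.
  by case: tpermP.
(* The events [E x] for [x] in [A] are disjoint because the maximum is attained once. *)
have sumE (C : {set 'I_n}) : C \subset A ->
    \sum_(x in C) #|E x| = #|[set a : 'S_n | [exists x in C, [forall z in A, a z <= a x]]]|.
  move=> CA; under eq_bigr do rewrite -sum1_card big_mkcond.
  rewrite exchange_big -sum1_card [RHS]big_mkcond /=; apply: eq_bigr => a _.
  have [x xA xE] := perm_argmax a A0.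
  have iffE y : y \in C -> (a \in E y) = (y == x).
    by move=> /(subsetP CA) yA; rewrite -xE yA inE.
  rewrite -big_mkcondr (eq_bigl (fun y => (x \in C) && (y == x))) => [|y]; last first.
    case: (boolP (y \in C)) => [yC|/negPf yC]; first rewrite iffE //.
      by case: eqP yC => [-> ->|]; rewrite ?andbF.
    by case: eqP yC => [-> ->|]; rewrite ?andbF.
  rewrite inE; have -> : [exists y in C, [forall z in A, a z <= a y]] = (x \in C).
    apply/exists_inP/idP=> [[y yC h]|xC].
      by have := iffE y yC; rewrite inE h => /esym/eqP<-.
    by exists x => //; have := iffE x xC; rewrite inE eqxx.
  by case: (x \in C); rewrite ?big_pred0_eq // big_pred1_eq.
have [x0 x0A] := set0Pn _ A0.
have cE (C : {set 'I_n}) : C \subset A -> \sum_(x in C) #|E x| = #|C| * #|E x0|.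
  move=> CA; rewrite -sum_nat_const; apply: eq_bigr => x /(subsetP CA) xA.
  by apply/eqP; rewrite eqn_leq !EE.
have tot : #|A| * #|E x0| = n`!.
  rewrite -cE // sumE // -[in RHS](card_ord n) -cardsT -card_Sym; apply: eq_card => a.
  rewrite !inE; have [x xA xE] := perm_argmax a A0; transitivity true.
    by apply/exists_inP; exists x => //; have := xE x; rewrite eqxx => /andP[].
  by apply/esym/subsetP=> y; rewrite inE.
by rewrite -sumE // cE // mulnAC -mulnA tot.
Qed.

End Argmax.

End PermutationCounting.

(** * Rearrangements of a tuple and averages over the symmetric group *)

Section TupleStatistics.
Local Open Scope nat_scope.
Variables s b : nat.
Implicit Types (mu nu : s.-tuple 'I_b.+1) (i : 'I_s).

Lemma perm_part_of mu : perm_eq (part_of mu) [seq val x | x <- mu].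
Proof. by rewrite perm_sort. Qed.

Lemma count_part_of mu (a : pred nat) : count a (part_of mu) = #|[set i | a (entry mu i)]|.
Proof.
rewrite (seq.permP (perm_part_of mu)) count_map -sum1_count big_tuple big_mkcond.
by rewrite -sum1_card [RHS]big_mkcond; apply: eq_bigr => i _; rewrite inE.
Qed.

Lemma sumn_part_of mu : sumn (part_of mu) = \sum_i entry mu i.
Proof. by rewrite (perm_sumn (perm_part_of mu)) sumnE big_map big_tuple. Qed.

Lemma size_part_of mu : size (part_of mu) = s.
Proof. by rewrite size_sort size_map size_tuple. Qed.

Lemma mem_part_of mu v : (v \in part_of mu) = [exists i, entry mu i == v].
Proof.
rewrite mem_sort; apply/mapP/existsP=> [[x /tnthP[i ->] ->]|[i /eqP <-]].
  by exists i.
by exists (tnth mu i) => //; apply: mem_tnth.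
Qed.

Lemma entry_le_part_max mu i : entry mu i <= part_max (part_of mu).
Proof.
have : entry mu i \in part_of mu by rewrite mem_part_of; apply/existsP; exists i.
rewrite /part_max; have := sort_sorted leq_total [seq val x | x <- mu].
rewrite -/(part_of mu); case/lastP: (part_of mu) => [//|l x]; rewrite last_rcons.
rewrite mem_rcons inE => srt /predU1P[->//|].
by move: srt; rewrite (sorted_pairwise leq_trans) pairwise_rcons => /andP[/allP h _] /h.
Qed.

Lemma part_max_entry mu : 0 < s -> exists i, entry mu i = part_max (part_of mu).
Proof.
move=> s0; have : part_max (part_of mu) \in part_of mu.
  have := size_part_of mu; rewrite /part_max; case: (part_of mu) => [s00|x l _].
    by rewrite -s00 in s0.
  exact: mem_last.
by rewrite mem_part_of => /existsP[i /eqP]; exists i.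
Qed.

Lemma part_of_eqP mu nu :
  reflect (exists a, nu = permute mu a) (part_of nu == part_of mu).
Proof.
apply: (iffP eqP) => [/(perm_sortP leq_total leq_trans anti_leq)|[a ->]].
  move=> /(perm_map_inj val_inj)/tuple_permP[a e]; exists a.
  exact: val_inj.
apply/(perm_sortP leq_total leq_trans anti_leq)/perm_map.
by apply/tuple_permP; exists a.
Qed.

Definition fiber_factorials mu := \prod_(v : 'I_b.+1) #|[set i | tnth mu i == v]|`!.

(** Orbit-stabilizer: the permutations producing a given rearrangement form a coset of the
    stabilizer of [mu], whose order is given by [card_perm_fibers]. *)
Lemma sum_permute mu (g : s.-tuple 'I_b.+1 -> nat) :
  \sum_(a : 'S_s) g (permute mu a) =
  (\sum_(nu | part_of nu == part_of mu) g nu) * fiber_factorials mu.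
Proof.
rewrite (partition_big (permute mu) (fun nu => part_of nu == part_of mu)) => [|a _]; last first.
  by apply/part_of_eqP; exists a.
rewrite big_distrl; apply: eq_bigr => _ /part_of_eqP[a0 ->] /=.
rewrite (eq_bigr (fun=> g (permute mu a0))) => [|a /eqP-> //].
rewrite sum_nat_const mulnC; congr (_ * _); rewrite /fiber_factorials -card_perm_fibers.
rewrite -[RHS](card_imset _ (mulgI a0)); apply: eq_card => a.
apply/idP/imsetP => [/eqP/val_inj e|[c + ->]].
  exists (a0^-1 * a)%g; last by rewrite mulKVg.
  rewrite inE; apply/forallP=> x; rewrite permM.
  by have := congr1 (fun nu => tnth nu (a0^-1%g x)) e; rewrite !tnth_mktuple permKV => ->.
rewrite inE => /forallP h; apply/eqP; congr val; apply: eq_from_tnth => x.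
by rewrite !tnth_mktuple permM (eqP (h _)).
Qed.

Definition zeros_before_top mu := #|[set i | (entry mu i == 0) &&
  [exists i' : 'I_s, (i < i') && (entry mu i' == part_max (part_of mu))]]|.

(* [k] zeros all precede the last maximal entry iff the last position among
   these zeros and the maximal entries is that of a maximal entry. *)
Lemma sum_perm_zeros mu k : 0 < s -> 0 < part_max (part_of mu) ->
  (\sum_(a : 'S_s) 'C(zeros_before_top (permute mu a), k)) * (part_r (part_of mu) + k) =
  'C(count_mem 0 (part_of mu), k) * part_r (part_of mu) * s`!.
Proof.
move=> s0 top0; set top := part_max _ in top0 *.
rewrite /part_r !count_part_of -/top.
set R := [set i | _ == top]; set Z := [set i | _ == 0].
(* In [permute mu a^-1] the entry of [mu] at [x] sits at position [a x], so [Y a] indexes the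
   counted zeros by their original positions. *)
pose Y (a : 'S_s) := [set x in Z | [exists y in R, a x < a y]].
have zY a : zeros_before_top (permute mu a^-1) = #|Y a|.
  rewrite -(card_imset _ (@perm_inj _ a)) /zeros_before_top.
  have -> : part_of (permute mu a^-1) = part_of mu.
    by apply/eqP/part_of_eqP; exists (a^-1)%g.
  apply: eq_card => x; rewrite -/top inE entry_permute; apply/andP/imsetP => /=.
    case=> zx /existsP[y /andP[xy ty]]; exists (a^-1 x)%g; last by rewrite permKV.
    rewrite !inE zx; apply/exists_inP; exists (a^-1 y)%g; rewrite ?permKV //.
    by rewrite inE -entry_permute.
  case=> x'; rewrite !inE => /andP[zx /exists_inP[y + lt] ->]; rewrite inE permK => yR.
  by split=> //; apply/existsP; exists (a y); rewrite lt entry_permute permK.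
(* The binomial coefficient counts the [k]-subsets of [Y a]; the sums over permutations and over
   subsets are exchanged below. *)
rewrite (reindex_inj invg_inj) /=; under eq_bigr => a _ do rewrite zY -cards_draws -sum1_card.
have [x0 x0R] : exists x0, x0 \in R.
  by have [x0 e] := part_max_entry mu s0; exists x0; rewrite inE e.
have SY (S : {set 'I_s}) (a : 'S_s) : S \subset Z ->
    (S \subset Y a) = [exists x in R, [forall z in R :|: S, a z <= a x]].
  move=> SZ; apply/subsetP/exists_inP=> [h|[x xR /forall_inP h] z zS].
    have Rn0 : R != set0 by apply/set0Pn; exists x0.
    have [x xR xm] := perm_argmax a Rn0.
    have := xm x; rewrite eqxx => /andP[_ /forall_inP xmax].
    exists x => //; apply/forall_inP=> z /setUP[/xmax //|/h].
    rewrite inE => /andP[_ /exists_inP[y yR lt]].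
    exact: leq_trans (ltnW lt) (xmax y yR).
  have zZ := subsetP SZ z zS; rewrite inE zZ; apply/exists_inP; exists x => //.
  rewrite ltn_neqAle h ?inE ?zS ?orbT // andbT (inj_eq val_inj) (inj_eq perm_inj).
  apply: contraTneq zZ => ->; move: xR; rewrite !inE => /eqP->.
  by rewrite -lt0n.
(* A maximal entry comes last among the disjoint sets [R] and [S] for a proportion
   [#|R| / (#|R| + k)] of the permutations. *)
have cardS (S : {set 'I_s}) : S \subset Z -> #|S| = k ->
    #|[set a : 'S_s | S \subset Y a]| * (#|R| + k) = #|R| * s`!.
  move=> SZ <-; have <- : #|R :|: S| = #|R| + #|S|.
    rewrite cardsU; have -> : R :&: S = set0; last by rewrite cards0 subn0.
    apply/setP=> x; rewrite !inE; apply/negbTE/negP=> /andP[/eqP e /(subsetP SZ)].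
    by rewrite inE e -leqn0 leqNgt top0.
  rewrite -(@card_perm_argmax s (R :|: S) R) ?subsetUl //; last first.
    by apply/set0Pn; exists x0; rewrite inE x0R.
  by congr (_ * _); apply: eq_card => a; rewrite !inE SY.
under eq_bigr do rewrite big_mkcond.
rewrite exchange_big big_distrl /= -cards_draws -mulnA -sum_nat_const /=.
rewrite [RHS]big_mkcond; apply: eq_bigr => S _; rewrite inE.
have [/andP[SZ /eqP Sk]|no] := boolP ((S \subset Z) && (#|S| == k)).
  rewrite -(cardS S SZ Sk) -sum1_card [in RHS]big_mkcond; congr (_ * _).
  by apply: eq_bigr => a _; rewrite !inE Sk eqxx andbT.
rewrite big1 // => a _; rewrite inE; case: ifP => // /andP[SY' Sk].
case/negP: no; rewrite Sk andbT; apply: subset_trans SY' _.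
by apply/subsetP=> x; rewrite inE => /andP[].
Qed.

End TupleStatistics.

(** * From averages over permutations to sums over rearrangements *)

Section FiberSum.
Local Open Scope nat_scope.

(** Multinomial coefficients are integers, so the division by [type_fact] in the final formula is
    exact. *)
Lemma dvdn_prod_fact (I : Type) (r : seq I) (t : I -> nat) :
  \prod_(i <- r) (t i)`! %| (\sum_(i <- r) t i)`!.
Proof.
elim: r => [|i r IHr]; first by rewrite !big_nil.
rewrite !big_cons; apply: dvdn_trans (dvdn_mul (dvdnn _) IHr) _.
by rewrite -(bin_fact (leq_addr (\sum_(j <- r) t j) (t i))) addKn dvdn_mull.
Qed.

(** Here [z], [p] and [r] count the zeros, the intermediate entries and the maxima; [N] is the sum
    over rearrangements and [D] the sum over permutations. Clearing factorials turns the solution of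
    the two equations into the stated product. *)
Lemma solve_fiber_sum N D n z ty p r k : n = z + p + r -> 0 < r -> 0 < ty -> ty %| p`! ->
    N * (z`! * ty * r`!) = D -> D * (r + k) = 'C(z, k) * r * n`! ->
  N = p`! %/ ty * 'C(n, p) * 'C(n - p, r + k) * 'C(r + k - 1, k).
Proof.
move=> -> r0 ty0 /divnK; set Q := _ %/ ty => Qty ND Dk.
have E0 : 0 < z`! * ty * r`! * (r + k) by rewrite !muln_gt0 !fact_gt0 ty0 addn_gt0 r0.
have {ND Dk}ND : N * (z`! * ty * r`! * (r + k)) = 'C(z, k) * r * (z + p + r)`!.
  by rewrite -Dk -ND !mulnA.
have sp : z + p + r - p = z + r by rewrite addnAC addnK.
have Bp := bin_fact (leq_trans (leq_addl z p) (leq_addr r (z + p))).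
rewrite sp in Bp *; set B := 'C(_, p) in Bp *.
apply/eqP; rewrite -(eqn_pmul2r E0) {}ND.
(* For [z < k] both sides vanish. *)
have [zk|kz] := ltnP z k.
  by rewrite bin_small // (bin_small (_ : z + r < r + k)) ?muln0 // addnC ltn_add2l.
have C1 : 'C(z + r, r + k) * ((r + k)`! * (z - k)`!) = (z + r)`!.
  rewrite -(@bin_fact (z + r) (r + k)) 1?(addnC z) ?leq_add2l //.
  by rewrite subnDl.
have C2 : 'C(r + k - 1, k) * (k`! * r.-1`!) = (r + k - 1)`!.
  by rewrite -(@bin_fact (r + k - 1) k) ?subn1; [congr (_ * (_ * _`!)); lia | lia].
have F1 : (r + k)`! = (r + k) * (r + k - 1)`!.
  by case: (r) r0 => // r' _; rewrite addSn factS subn1.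
have F2 : r`! = r * r.-1`! by case: (r) r0 => // r' _; rewrite factS.
have kw0 : 0 < k`! * (z - k)`! by rewrite muln_gt0 !fact_gt0.
rewrite -(eqn_pmul2r kw0); apply/eqP.
transitivity (('C(z, k) * (k`! * (z - k)`!)) * r * (z + p + r)`!); first by ring.
rewrite bin_fact // -Bp -C1 F1 -C2 F2 -Qty; ring.
Qed.

Variables s b : nat.
Implicit Types (mu nu : s.-tuple 'I_b.+1).

Lemma part_split mu (l := part_of mu) : 0 < part_max l ->
  s = count_mem 0 l + part_p l + part_r l.
Proof.
move=> top0; rewrite -{1}(size_part_of mu) -/l /part_p /part_pi /part_r size_filter.
rewrite -!sum1_count -sum1_size (big_mkcond (pred1 0)).
rewrite (big_mkcond (fun v => 0 < v < part_max l)) (big_mkcond (pred1 (part_max l))).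
rewrite -!big_split; apply: eq_big_seq => x /=.
rewrite mem_part_of => /existsP[i /eqP <-]; have := entry_le_part_max mu i.
rewrite -/l; move: (entry mu i) (part_max l) top0 => e t; do ![case: ifP]; lia.
Qed.

Lemma sum_count_part_pi mu (l := part_of mu) :
  \sum_(1 <= v < part_max l) count_mem v l = part_p l.
Proof.
rewrite /part_p /part_pi size_filter -sum1_count.
under eq_bigr do rewrite -sum1_count big_mkcond.
rewrite exchange_big [RHS]big_mkcond; apply: eq_bigr => x _ /=.
rewrite -big_mkcond sum1_count -(@eq_count _ (pred1 x)); last by move=> v; rewrite /= eq_sym.
by rewrite count_uniq_mem ?iota_uniq // mem_index_iota; case: ifP.
Qed.

Lemma fiber_factorialsE mu (l := part_of mu) : 0 < part_max l -> part_max l <= b ->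
  fiber_factorials mu = (count_mem 0 l)`! * type_fact l * (part_r l)`!.
Proof.
move=> top0 topb; rewrite /fiber_factorials.
rewrite (eq_bigr (fun v : 'I_b.+1 => (count_mem (val v) l)`!)) => [|v _]; last first.
  by rewrite count_part_of.
rewrite -(big_mkord predT (fun v => (count_mem v l)`!)).
rewrite (@big_cat_nat _ _ _ (part_max l).+1) //= big_nat_recr //= [X in _ * X]big1_seq.
  by rewrite muln1 big_ltn.
(* Values above the maximum have empty fibers and contribute the factor 1. *)
move=> v; rewrite mem_index_iota => /andP[_ /andP[tv _]].
rewrite (count_memPn _) // mem_part_of negb_exists; apply/forallP=> i.
by rewrite neq_ltn (leq_ltn_trans (entry_le_part_max _ _) tv).
Qed.

Lemma sum_bin_zeros mu k (l := part_of mu) : 0 < s -> 0 < part_max l ->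
  \sum_(nu : s.-tuple 'I_b.+1 | part_of nu == l) 'C(zeros_before_top nu, k) =
  (part_p l)`! %/ type_fact l * 'C(s, part_p l) *
    'C(s - part_p l, part_r l + k) * 'C(part_r l + k - 1, k).
Proof.
move=> s0 top0; have [i ei] := part_max_entry mu s0.
have topb : part_max l <= b by rewrite /l -ei entry_le.
have r0 : 0 < part_r l.
  by rewrite /part_r -has_count has_pred1 mem_part_of; apply/existsP; exists i; apply/eqP.
have ty0 : 0 < type_fact l by rewrite prodn_gt0 // => v; apply: fact_gt0.
have tyd : type_fact l %| (part_p l)`!.
  by rewrite -sum_count_part_pi; apply: dvdn_prod_fact.
have := sum_perm_zeros k s0 top0.
rewrite (sum_permute mu (fun nu => 'C(zeros_before_top nu, k))) fiber_factorialsE // -/l.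
exact: solve_fiber_sum (part_split top0) r0 ty0 tyd erefl.
Qed.

End FiberSum.

(** * The Betti numbers *)

Section ColonCardinal.
Local Open Scope nat_scope.

Lemma card_ord_ltn n m : m <= n -> #|[pred j : 'I_n | j < m]| = m.
Proof.
move=> mn; rewrite -sum1_card -(big_ord_widen n (fun=> 1) mn).
by rewrite sum_nat_const card_ord muln1.
Qed.

(** Let M be the largest entry. A nonzero entry e can only be lowered in place, in e - 1 ways. At a
    zero, each of the M - 1 smaller positive values decreases the weight, and M itself does so
    exactly when an M stands further right. These counts add up to the formula. *)
Lemma card_colon_set s b (mu : s.-tuple 'I_b.+1) : 0 < s -> 0 < part_max (part_of mu) ->
  #|colon_set mu| = p_triangle (part_of mu) + zeros_before_top mu.
Proof.
move=> s0; set l := part_of mu; set M := part_max l => M0.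
have [i0 ei0] := part_max_entry mu s0; rewrite -/l -/M in ei0.
have Mb : M <= b by rewrite -ei0 entry_le.
have leM i : entry mu i <= M := entry_le_part_max mu i.
pose zb i := [exists i' : 'I_s, (i < i') && (entry mu i' == M)].
pose c i := if entry mu i == 0 then M - 1 + zb i else entry mu i - 1.
(* The index [j] stands for the value [j.+1], so [j < M - 1] covers the values below M and
   [j = M - 1] is the value M. *)
have cond i (j : 'I_b) : [exists i', ((i' == i) || (entry mu i == 0)) &&
    (position_weight b j.+1 i < position_weight b (entry mu i') i')] = (j < c i).
  have jn0 : j.+1 != 0 by [].
  rewrite /c; case: (eqVneq (entry mu i) 0) => [z|nz]; last first.
    transitivity (position_weight b j.+1 i < position_weight b (entry mu i) i).
      apply/existsP/idP=> [[i' /andP[]]|h]; first by rewrite orbF => /eqP->.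
      by exists i; rewrite eqxx.
    by rewrite ltnNge position_weight_le -ltnNge ltn_subRL add1n.
  apply/existsP/idP=> [[i' /andP[_ lt]]|].
    have le := leq_trans (position_weight_lt jn0 lt) (leM i').
    have [jM|jM] := ltnP j (M - 1); first by rewrite ltn_addr.
    have ji : entry mu i' = j.+1.
      by have := position_weight_lt jn0 lt; have := leM i'; lia.
    have -> : zb i; last by lia.
    apply/existsP; exists i'; apply/andP; split; last by rewrite ji; apply/eqP; lia.
    by move: lt; rewrite ji !position_weightE // !ltn_add2l.
  rewrite /zb => jlt; have [jM|jM] := ltnP j (M - 1).
    exists i0; rewrite orbT ei0 !position_weightE -?lt0n // ltn_add2l.
    have : j.+2 * s <= M * s by rewrite leq_mul2r; apply/orP; right; lia.
    by have := ltn_ord i; rewrite mulSn; lia.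
  move: jlt; case: existsP => [[i' /andP[ii' /eqP e]] jlt|_]; last by rewrite addn0 ltnNge jM.
  exists i'; rewrite orbT e !position_weightE -?lt0n // ltn_add2l.
  have -> : M = j.+1 by lia.
  by rewrite ltn_add2l.
have cb i : c i <= b.
  rewrite /c; case: eqP => _; last by have := leM i; lia.
  by have := leq_b1 (zb i); lia.
rewrite card_in_imset => [|[i j] [i' j'] _ _ /eqP]; last first.
  by rewrite eq_mxvec_index => /andP[/eqP /= -> /eqP /= ->].
have -> : #|[set p : 'I_s * 'I_b | [exists i', ((i' == p.1) || (entry mu p.1 == 0)) &&
    (position_weight b p.2.+1 p.1 < position_weight b (entry mu i') i')]]| = \sum_i c i.
  rewrite -sum1_card (eq_bigl (fun p : 'I_s * 'I_b => xpredT p.1 && (p.2 < c p.1)));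
    last by move=> p; rewrite inE cond.
  rewrite -(pair_big_dep xpredT (fun i (j : 'I_b) => j < c i) (fun _ _ => 1)) /=.
  by apply: eq_bigr => i _; rewrite sum1_card card_ord_ltn.
have zE : zeros_before_top mu = \sum_(i < s) ((entry mu i == 0) && zb i).
  rewrite /zeros_before_top -sum1_card big_mkcond; apply: eq_bigr => i _.
  by rewrite inE -/l -/M; case: (_ && _).
have suppE : suppdeg l = \sum_(i < s) (entry mu i != 0).
  rewrite /suppdeg count_part_of -sum1_card big_mkcond; apply: eq_bigr => i _.
  by rewrite inE; case: (_ != _).
have key : \sum_i c i + M * suppdeg l = sumn l + s * (M - 1) + zeros_before_top mu.
  rewrite sumn_part_of suppE zE big_distrr -[s in s * _]card_ord -sum_nat_const.
  rewrite -!big_split; apply: eq_bigr => i _ /=; rewrite /c.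
  by case: (eqVneq (entry mu i) 0) => [->|] /=; have := leM i; lia.
rewrite /p_triangle size_part_of -/M.
(* This bound shows that the subtraction in [p_triangle] is not truncated. *)
have le : M * suppdeg l <= sumn l + s * (M - 1).
  rewrite sumn_part_of suppE big_distrr -[s in s * _]card_ord -sum_nat_const -big_split.
  apply: leq_sum => i _ /=; case: (eqVneq (entry mu i) 0) => [->|] /=; lia.
by lia.
Qed.

End ColonCardinal.

(** * Linear quotients of J and the sum over its generators *)

Section GensList.
Local Open Scope nat_scope.
Variables (K : fieldType) (s b : nat) (J : {pred {mpoly K[s * b]}}).
Hypothesis hJ : sparse_symmetric_shifted J.
Implicit Types (mu nu : s.-tuple 'I_b.+1).

Lemma has_betti_shifted : has_betti J (fun i j => \sum_(mu | in_gens J mu)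
  (j == (i + mdeg (sparse_mon mu))%N) * 'C(#|colon_set mu|, i)).
Proof.
(* The list is sorted by decreasing weight because [has_betti_linear_quotients] adds generators from
   the right end. *)
pose leT mu nu := weight nu <= weight mu.
pose gens := sort leT [seq mu <- index_enum (s.-tuple 'I_b.+1) | in_gens J mu].
have gensE : gens =i in_gens J.
  by move=> mu; rewrite mem_sort mem_filter mem_index_enum andbT.
have gens_uniq : uniq gens by rewrite sort_uniq filter_uniq // index_enum_uniq.
have leTtr : transitive leT by move=> y x z xy yz; apply: leq_trans yz xy.
have gens_sorted : pairwise leT gens.
  by rewrite -sorted_pairwise // sort_sorted // => x y; apply: leq_total.
apply: eq_has_betti
  (@has_betti_linear_quotients K _ _ (@sparse_mon s b) (@colon_set s b) gens _).
- exact: mon_ideal_gens.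
- by move=> i j; rewrite (perm_big _ (permEl (perm_sort _ _))) big_filter.
move=> s1 mu s2 e.
have memG nu : nu \in s1 ++ mu :: s2 -> in_gens J nu by rewrite -e gensE.
have muG : in_gens J mu by apply: memG; rewrite mem_cat inE eqxx orbT.
move: gens_sorted gens_uniq; rewrite e pairwise_cat cat_uniq /= => /and3P[/allrelP s12 _].
move=> /andP[/allP s2le _] /and3P[_ /norP[mus1 _] /andP[mus2 _]].
split=> [nu /s2le /weight_mdeg //|t].
(* If [t] avoided the colon set, [weight_gens_lt] would make the dividing generator [nu] heavier
   than [mu], contrary to the order. *)
apply/hasP/exists_inP=> [[nu nus2 le]|[k kmu tk]].
  have nuG : in_gens J nu by apply: memG; rewrite mem_cat inE nus2 !orbT.
  have nemu : nu != mu by apply: contraNneq mus2 => <-.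
  apply/exists_inP; apply: contraLR (s2le _ nus2); rewrite negb_exists_in => /forall_inP t0.
  rewrite -ltnNge; apply: (weight_gens_lt hJ muG) nemu.
  - exact: gens_in_ideal.
  - exact/weight_mdeg/s2le.
  move=> i i' nui ii'; rewrite leqNgt; apply/negP=> lt.
  have [j ej] : exists j : 'I_b, entry nu i = j.+1.
    by have := entry_le nu i; case: (entry nu i) nui => // j _ jb; exists (Ordinal jb).
  have /t0 : mxvec_index i j \in colon_set mu.
    apply/imsetP; exists (i, j) => //; rewrite inE; apply/existsP; exists i'.
    by rewrite ii' -ej.
  rewrite negbK => /eqP t0k.
  (* As [t] lacks z_{i,j+1}, this variable of z^nu comes from z^mu, so [nu] and [mu] agree at [i];
     neither kind of move can then decrease the weight. *)
  have /sparse_monP/(_ i j ej) := le; rewrite mnmDE t0k addn0 sparse_monE eqb0 negbK.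
  move/eqP=> emu; case/orP: ii' lt => [/eqP->|]; last by rewrite emu.
  by rewrite ej emu ltnn.
have [nu [nuG lt /(_ t tk) le]] := colon_set_sub hJ muG kmu.
exists nu => //; have : nu \in gens by rewrite gensE.
rewrite e mem_cat inE => /or3P[nus1|/eqP nue|//].
  have := s12 nu mu nus1 (mem_head _ _); rewrite /leT leqNgt lt //.
by rewrite nue ltnn in lt.
Qed.

(** A divisor in J of the permuted generator is brought back by the inverse permutation to a divisor
    of z^mu. *)
Lemma in_gens_permute mu a : in_gens J mu -> in_gens J (permute mu a).
Proof.
move=> muG; apply/mingensP; split; first exact/ideal_permute/gens_in_ideal.
move=> m mJ mle; have [nu nuG num] := gens_dvd hJ mJ.
have nuJ := ideal_permute hJ (a^-1)%g (gens_in_ideal nuG).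
have nule := lepm_trans num mle.
have : sparse_mon (permute nu a^-1) = sparse_mon mu.
  have /mingensP[_] := muG; apply=> //; apply/sparse_mon_le => i.
  rewrite entry_permute => /(sparse_mon_le _ _ nule) ->.
  by rewrite entry_permute permKV.
move/sparse_mon_inj=> e; apply/mnmP=> k; apply/eqP; rewrite eqn_leq.
rewrite (mnm_lepP mle) /=; suff -> : permute mu a = nu by apply: (mnm_lepP num).
by rewrite -e; apply: entry_inj => i; rewrite !entry_permute permK.
Qed.

(** The zero tuple has monomial 1, which properness keeps out of J. *)
Lemma part_max_gens mu : 0 < s -> in_gens J mu -> 0 < part_max (part_of mu).
Proof.
move=> s0 muG; rewrite lt0n; apply/eqP=> z.
have [_ J1 _] := sss_ideal hJ; case/negP: J1; rewrite -mpolyX0.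
suff <- : sparse_mon mu = 0%MM by apply: gens_in_ideal.
apply/eqP; rewrite -mdeg_eq0 mdeg_sparse_mon big1 // => i _.
by have := entry_le_part_max mu i; rewrite z leqn0 => /eqP->.
Qed.

Lemma LambdaP l : reflect (exists2 mu, in_gens J mu & l = part_of mu) (l \in Lambda J).
Proof.
rewrite mem_undup; apply: (iffP mapP) => -[mu muG ->]; exists mu => //.
  by move: muG; rewrite mem_enum.
by rewrite mem_enum.
Qed.

(** By symmetry the generators form full rearrangement classes, and the list [Lambda J] has each
    class once. *)
Lemma sum_gens_Lambda (P : pred (seq nat)) (f : s.-tuple 'I_b.+1 -> nat) :
  \sum_(mu | in_gens J mu && P (part_of mu)) f mu =
  \sum_(l <- Lambda J | P l) \sum_(mu : s.-tuple 'I_b.+1 | part_of mu == l) f mu.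
Proof.
rewrite (exchange_big_dep predT) //= [LHS]big_mkcond; apply: eq_bigr => mu _.
rewrite (eq_bigr (fun=> 1 * f mu)) => [|l _]; last by rewrite mul1n.
rewrite -big_distrl sum1_count /=.
have -> : in_gens J mu = (part_of mu \in Lambda J).
  apply/idP/LambdaP=> [muG|[nu nuG /eqP/part_of_eqP[a ->]]]; first by exists mu.
  exact: in_gens_permute.
have -> : count (fun l => P l && (part_of mu == l)) (Lambda J) =
    (P (part_of mu) * count_mem (part_of mu) (Lambda J))%N.
  have [Pm|Pm] := boolP (P (part_of mu)).
    rewrite mul1n; apply: eq_count => l /=; rewrite [RHS]eq_sym.
    by case: eqP => [<-|_]; rewrite ?Pm ?andbF.
  rewrite mul0n; apply/eqP; rewrite -leqn0 leqNgt -has_count; apply/hasPn=> l _.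
  by apply: contra Pm => /andP[+ /eqP->].
rewrite count_uniq_mem ?undup_uniq //.
by case: (_ \in _); case: (P _); rewrite ?mul0n ?mul1n.
Qed.

End GensList.

Theorem corollary2p18 (K : fieldType) (s b : nat) (hs : (1 <= s)%N) (hb : (1 <= b)%N)
    (J : {pred {mpoly K[s * b]}}) (hJ : sparse_symmetric_shifted J)
    (i : nat) (d : int) :
  graded_betti J i (i%:Z + d)
    (\sum_(l <- Lambda J | (suppdeg l)%:Z == d)
       \sum_(k < i.+1)
         ((part_p l)`! %/ type_fact l) * 'C(p_triangle l, i - k) * 'C(s, part_p l)
         * 'C(s - part_p l, part_r l + k) * 'C(part_r l + k - 1, k))%N.
Proof.
have -> : (\sum_(l <- Lambda J | (suppdeg l)%:Z == d)
       \sum_(k < i.+1)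
         ((part_p l)`! %/ type_fact l) * 'C(p_triangle l, i - k) * 'C(s, part_p l)
         * 'C(s - part_p l, part_r l + k) * 'C(part_r l + k - 1, k) =
    \sum_(mu : s.-tuple 'I_b.+1 | in_gens J mu)
      ((i%:Z + d)%R == (i + mdeg (sparse_mon mu))%N) * 'C(#|colon_set mu|, i))%N.
  rewrite (eq_bigr (fun mu => if (suppdeg (part_of mu))%:Z == d
      then 'C(p_triangle (part_of mu) + zeros_before_top mu, i) else 0)%N); last first.
    move=> mu muG; rewrite card_colon_set ?(part_max_gens hJ) //.
    have -> : mdeg (sparse_mon mu) = suppdeg (part_of mu).
      rewrite /suppdeg count_part_of mdeg_sparse_mon -sum1_card [RHS]big_mkcond.
      by apply: eq_bigr => k _; rewrite inE; case: (_ != _).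
    rewrite PoszD (inj_eq (addrI _)) eq_sym.
    by case: ifP => _; rewrite ?mul1n ?mul0n.
  rewrite -big_mkcondr /= (sum_gens_Lambda hJ (fun l => (suppdeg l)%:Z == d)).
  rewrite big_seq_cond [RHS]big_seq_cond; apply: eq_bigr => l /andP[lL _].
  have [mu muG ->] := LambdaP _ _ lL; have mu0 := part_max_gens hJ hs muG.
  (* Within a class only [zeros_before_top] varies; Vandermonde isolates it in one factor, whose sum
     is [sum_bin_zeros]. *)
  have VM (nu : s.-tuple 'I_b.+1) : part_of nu == part_of mu ->
      'C(p_triangle (part_of nu) + zeros_before_top nu, i) =
      (\sum_(k < i.+1) 'C(p_triangle (part_of mu), i - k) * 'C(zeros_before_top nu, k))%N.
    move/eqP->; rewrite addnC -binomial.Vandermonde.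
    by apply: eq_bigr => k _; rewrite mulnC.
  rewrite (eq_bigr _ VM) exchange_big; apply: eq_bigr => k _ /=.
  by rewrite -big_distrr sum_bin_zeros //=; ring.
exact: has_betti_graded i (i%:Z + d) (has_betti_shifted hJ).
Qed.
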